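(* Let $m$ be a positive integer, let $K\neq 2^{[m]}$ be a simplicial complex on $[m]$ (possibly with ghost vertices), and let $I,J$ be subsets of $[m]$. Then the full subcomplex $\operatorname{Bier}(K)|_{I\sqcup\bar J}$ of the Bier sphere $\operatorname{Bier}(K)$ with respect to $I\sqcup\bar J\subset[m]\sqcup[\bar m]$ is homotopy equivalent to (1) the $(|I|-1)$-sphere, if $I=J$, $I\in K$, and $\bar I\in\hat K$; (2) the $(|I|-2)$-sphere, if $I=J$, $I\notin K$, and $\bar I\notin\hat K$; (3) $\Sigma^{|J|}\operatorname{Lk}(J,K|_I)$, if $J\subsetneq I$ and $J\in K$; (4) $\Sigma^{|I|}\operatorname{Lk}(\bar I,\hat K|_{\bar J})$, if $J\supsetneq I$ and $\bar I\in\hat K$; (5) a point, otherwise. In particular, in case (1), $\operatorname{Bier}(K)|_{I\sqcup\bar I}$ is the boundary of an $|I|$-dimensional cross-polytope.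
   Context: $[m]=\{1,\dots,m\}$, $[\bar m]=\{\bar1,\dots,\bar m\}$ is a disjoint copy, and for $I\subset[m]$, $\bar I=\{\bar i: i\in I\}$. A simplicial complex on a finite set $S$ is a collection of subsets of $S$ closed under taking subsets and containing $\emptyset$; an element $v\in S$ with $\{v\}$ not a face is a ghost vertex. The Alexander dual of $K$ is the simplicial complex on $[\bar m]$ given by $\hat K=\{\bar\sigma\subseteq[\bar m]:\sigma\subseteq[m],\ [m]\setminus\sigma\notin K\}$. The Bier sphere is the simplicial complex on $[m]\sqcup[\bar m]$ given by $\operatorname{Bier}(K)=\{\sigma\sqcup\tau:\sigma\in K,\ \tau\in\hat K,\ \bar\sigma\cap\tau=\emptyset\}$. For a simplicial complex $\Gamma$ on $S$ and $W\subseteq S$, the full subcomplex is $\Gamma|_W=\{\sigma\in\Gamma:\sigma\subseteq W\}$. For $\sigma\in\Gamma$, the link is $\operatorname{Lk}(\sigma,\Gamma)=\{\tau\in\Gamma:\sigma\cap\tau=\emptyset,\ \sigma\cup\tau\in\Gamma\}$. The suspension $\Sigma\Gamma$ is the simplicial join of $\Gamma$ with the complex consisting of two new non-adjacent vertices; $\Sigma^k$ is the $k$-fold suspension and $\Sigma^0\Gamma=\Gamma$. Homotopy equivalence refers to geometric realizations; the complex $\{\emptyset\}$ has empty realization and is the $(-1)$-sphere, so $\Sigma^k\{\emptyset\}$ is a $(k-1)$-sphere. *)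

(* Defs.v *)
(* Simplicial complexes are finite sets of finite sets (MathComp); topology is
   MathComp-Analysis over an abstract realType. *)
From mathcomp Require Import all_boot.

Set Implicit Arguments.
Unset Strict Implicit.
Unset Printing Implicit Defensive.

(* A complex on (the full type) S; an element v : S with [set v] \notin G is a
   ghost vertex. *)
Definition simplicial_complex (S : finType) (G : {set {set S}}) : Prop :=
  set0 \in G /\ (forall s t : {set S}, t \in G -> s \subset t -> s \in G).

(* The result is kept as a complex on S: the elements outside W become ghosts. *)
Definition full_subcomplex (S : finType) (G : {set {set S}}) (W : {set S}) :
  {set {set S}} := [set s in G | s \subset W].

Definition link (S : finType) (s : {set S}) (G : {set {set S}}) :
  {set {set S}} := [set t in G | [disjoint s & t] && (s :|: t \in G)].

Definition disj_union (S T : finType) (s : {set S}) (t : {set T}) :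
  {set S + T} := (inl @: s) :|: (inr @: t).

Definition join (S T : finType) (G : {set {set S}}) (H : {set {set T}}) :
  {set {set S + T}} := [set disj_union s t | s in G, t in H].

Definition two_points : {set {set bool}} := [set set0; [set true]; [set false]].

Fixpoint susp_vertices (S : finType) (k : nat) : finType :=
  if k is k'.+1 then (susp_vertices S k' + bool)%type else S.

Fixpoint suspension (S : finType) (k : nat) (G : {set {set S}}) :
    {set {set susp_vertices S k}} :=
  if k is k'.+1 return {set {set susp_vertices S k}}
  then join (suspension k' G) two_points else G.

(* The set [m] is 'I_m, and barred m is its copy; the two are made disjoint by
   taking the sum type 'I_m + barred m. *)
Definition barred (m : nat) : finType := 'I_m.
Definition bar (m : nat) (i : 'I_m) : barred m := i.

Definition alexander_dual (m : nat) (K : {set {set 'I_m}}) :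
    {set {set barred m}} :=
  [set (@bar m) @: s | s : {set 'I_m} & ~: s \notin K].

Definition bier (m : nat) (K : {set {set 'I_m}}) :
    {set {set 'I_m + barred m}} :=
  [set disj_union s t | s in K, t in alexander_dual K
     & [disjoint ((@bar m) @: s) & t]].

(* The vertex map f goes from H to G: S may be inhabited by ghosts only while T
   is empty. Every element of T is a vertex in the use made of this notion. *)
Definition simplicial_iso (S T : finType) (G : {set {set S}})
    (H : {set {set T}}) : Prop :=
  exists f : T -> S, {in cover H &, injective f} /\
    G = [set f @: s | s : {set T} in H].

From mathcomp Require Import all_algebra all_classical all_reals all_analysis.
Import GRing.Theory Num.Theory numFieldNormedType.Exports.
Local Open Scope classical_set_scope.
Local Open Scope ring_scope.

(* Barycentric coordinates, with the topology of the product R^S; as a subtype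
   of it, the realization of [set set0] is an empty space. *)
Definition realization (R : realType) (S : finType) (G : {set {set S}}) :
    topologicalType :=
  set_type [set x : {ptws S -> R} |
    [/\ forall v, 0 <= x v, \sum_v x v = 1
      & [set v | x v != 0]%SET \in G]].

(* Meant for n >= -1: the unit sphere of R^(n+1), which is empty for n = -1. *)
Definition sphere (R : realType) (n : int) : topologicalType :=
  set_type [set x : 'rV[R]_(absz (n + 1)) | \sum_j (x ord0 j) ^+ 2 = 1].

Definition one_point (R : realType) : topologicalType :=
  set_type [set (0 : R)].

Definition homotopic (R : realType) (X Y : topologicalType) (f g : X -> Y) :
    Prop :=
  exists h : X * R -> Y,
    [/\ {within [set: X] `*` `[0, 1], continuous h},
        forall x, h (x, 0) = f x & forall x, h (x, 1) = g x].

Definition homotopy_equivalent (R : realType) (X Y : topologicalType) : Prop :=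
  exists (f : X -> Y) (g : Y -> X),
    [/\ continuous f, continuous g,
        homotopic R (g \o f) id & homotopic R (f \o g) id].

Definition cross_polytope (R : realType) (n : nat) : set 'rV[R]_n :=
  [set x | \sum_j `|x ord0 j| <= 1].

Definition cross_vertex (R : realType) (n : nat) (p : 'I_n * bool) :
  'rV[R]_n := (-1) ^+ p.2 *: delta_mx ord0 p.1.

(* The proper faces of a polytope P, the empty one included. *)
Definition proper_face (R : realType) (n : nat) (P F : set 'rV[R]_n) : Prop :=
  exists (a : 'rV[R]_n) (c : R),
    [/\ forall x, P x -> \sum_j a ord0 j * x ord0 j <= c,
        F = P `&` [set x | \sum_j a ord0 j * x ord0 j = c]
      & F <> P].

(* The boundary of the cross-polytope as a simplicial complex: the vertex sets
   of its proper faces. For n = 0 the polytope is a point, and this is {set0}. *)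
Definition cross_polytope_boundary (R : realType) (n : nat) :
    {set {set 'I_n * bool}} :=
  [set s : {set 'I_n * bool} |
    `[< exists2 F, proper_face (@cross_polytope R n) F
        & forall p, p \in s <-> F (cross_vertex R p) >]]%SET.

(* Main.v *)
Require Import Defs.
From mathcomp Require Import all_boot all_order all_algebra reals.
From mathcomp Require Import all_classical all_analysis ring lra.
Set Implicit Arguments.
Unset Strict Implicit.
Unset Printing Implicit Defensive.
Import Order.TTheory GRing.Theory Num.Theory numFieldNormedType.Exports.
Local Open Scope classical_set_scope.
Local Open Scope ring_scope.

(** Let L be the Alexander dual of K, so that s is a face of L if and only if
the complement of s is not a face of K. The pair of faces (s, t) of the Bier
sphere is read as the sign pattern of the vectors x of R^m that are positive on
s, negative on t and zero elsewhere. Up to positive rescaling the full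
subcomplex on I and J is then the set C of the nonzero x such that the positive
support of x is a face of K inside I and its negative support is a face of L
inside J ([realization_bier]). Everything is proved on such cones, with
homotopies that run along segments ([line_equivalence]).

The main tool is the threshold. If I is not a face of K and t grows, the set of
the i in I with x i + t > 0 grows from the empty set to I, so it stops being a
face of K at one value of t ([thresholdP]), which is a Lipschitz function of x.
At that value the nonnegative coordinates in I do not form a face of K, hence by
duality the negative coordinates of the raised vector form a face of L. Raising
the coordinates in I up to the threshold thus turns the condition on the
negative support into a consequence of the one on the positive support.

- If I = J is a face of both complexes, no condition is left: C is R^I without
  0, a sphere, and the complex consists of all sign patterns on I, which are the
  faces of a cross-polytope.
- If I = J is a face of neither, C meets every line parallel to the indicator
  of I in a segment or in the empty set, and the threshold is a section over
  the quotient of R^I by this direction, 0 removed ([cone_diagonal]).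
- If I = J is a face of exactly one of them, C is star-shaped about the
  indicator of I or its opposite ([cone_powerset_contractible]).
- If I is not contained in J, some coordinate only takes nonnegative values, so
  raising never meets 0. When I is a face of K, C is star-shaped about the
  indicator of I, and the link of J in K restricted to I, if J is contained in
  I, is a full simplex. When I is not a face of K, C is equivalent to the cone
  U obtained by forgetting L ([cone_retract_up]). Lowering the
  coordinates in J contracts U unless J is a face of K contained in I; in that
  case U retracts to the vectors whose positive support lies in the closed star
  of J in K restricted to I ([cone_retract_star]). There the coordinates in J
  are free and the others describe the link of J, so this is the suspension
  ([realization_suspension]).
- If J is not contained in I, changing the sign of x exchanges K with L and I
  with J ([cone_opp]). *)

(** * Homotopies *)

Section Topology.
Context (R : realType).

Lemma continuous_ptws (X : topologicalType) (T : finType)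
    (f : X -> {ptws T -> R}) (x : X) :
  (forall i, {for x, continuous (fun y => f y i)}) -> {for x, continuous f}.
Proof.
move=> fc; apply/cvg_sup => i U [? /= [[W oW <-]]] /= Wf /filterS; apply.
by apply: (fc i); exact: open_nbhs_nbhs.
Qed.

Lemma continuous_coord (T : finType) (i : T) :
  continuous (fun x : {ptws T -> R} => x i).
Proof. exact: proj_continuous. Qed.

Lemma continuous_set_type (X Y : topologicalType) (A : set Y)
    (f : X -> set_type A) :
  continuous (fun x => set_val (f x)) -> continuous f.
Proof. by move=> fc; exact: continuous_comp_initial. Qed.

Lemma continuous_within_comp (X Y Z : topologicalType) (A : set Y)
    (k : X -> Y) (h : Y -> Z) :
  {within A, continuous h} -> continuous k -> (forall x, A (k x)) ->
  continuous (h \o k).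
Proof.
move=> hc kc kA x U /= Uh;
  have : nbhs (k x : subspace A) (h @^-1` U) by exact: hc.
rewrite {1}/nbhs /= -nbhs_subspace_in; last exact: kA.
move=> /(kc x) Ak; apply: (@filterS _ (nbhs x) _ _ _ _ Ak) => y.
by apply; exact: kA.
Qed.

Lemma continuous_pair (X Y Z : topologicalType) (f : X -> Y) (g : X -> Z)
    (x : X) : {for x, continuous f} -> {for x, continuous g} ->
  {for x, continuous (fun y => (f y, g y))}.
Proof.
by move=> fc gc; exact: (@cvg_pair _ _ _ (nbhs x) (nbhs (f x)) (nbhs (g x))).
Qed.

Lemma continuous_fst (X Y : topologicalType) : continuous (@fst X Y).
Proof. by move=> z; exact: cvg_fst. Qed.

Lemma continuous_snd (X Y : topologicalType) : continuous (@snd X Y).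
Proof. by move=> z; exact: cvg_snd. Qed.

Definition clamp (t : R) : R := Num.max 0 (Num.min 1 t).

Lemma clamp_itv t : 0 <= clamp t <= 1.
Proof. by rewrite /clamp le_max lexx ge_max ler01 ge_min lexx. Qed.

Lemma clamp_id t : 0 <= t <= 1 -> clamp t = t.
Proof. by move=> /andP[t0 t1]; rewrite /clamp min_r // max_r. Qed.

Lemma continuous_const (X Y : topologicalType) (c : Y) (x : X) :
  {for x, continuous (fun=> c)}.
Proof. exact: cvg_cst. Qed.

Lemma continuous_maxr (X : topologicalType) (f g : X -> R) (x : X) :
  {for x, continuous f} -> {for x, continuous g} ->
  {for x, continuous (fun y => Num.max (f y) (g y))}.
Proof. by move=> fc gc; exact: (@continuous_max R X f g x fc gc). Qed.

Lemma continuous_clamp : continuous clamp.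
Proof.
move=> t; apply: continuous_maxr; first exact: cvg_cst.
exact: (@continuous_min R _ (cst 1) id t (@cst_continuous _ _ _ _) cvg_id).
Qed.

(** A homotopy defined over the times in [0, 1] extends to all times when
time is frozen outside of this interval; after that, no subspace topology has to
be dealt with. *)
Lemma homotopicP (X Y : topologicalType) (f g : X -> Y) :
  homotopic R f g <-> exists h : X * R -> Y,
    [/\ continuous h, forall x, h (x, 0) = f x & forall x, h (x, 1) = g x].
Proof.
split=> -[h [hc h0 h1]]; last first.
  by exists h; split=> //; exact: continuous_subspaceT.
exists (h \o (fun z => (z.1, clamp z.2))); split.
- apply: (continuous_within_comp hc) => [z|[x t]] /=.
    apply: continuous_pair; first exact: continuous_fst.
    by apply: (@continuous_comp _ _ _ snd clamp);
      [exact: continuous_snd|exact: continuous_clamp].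
  by split=> //=; rewrite in_itv /=; exact: clamp_itv.
- by move=> x /=; rewrite clamp_id ?h0 // lexx ler01.
- by move=> x /=; rewrite clamp_id ?h1 // lexx ler01.
Qed.

Lemma homotopic_comp (X Y Z W : topologicalType) (f g : Y -> Z) (k : X -> Y)
    (l : Z -> W) :
  continuous k -> continuous l -> homotopic R f g ->
  homotopic R (l \o f \o k) (l \o g \o k).
Proof.
move=> kc lc /homotopicP[h [hc h0 h1]]; apply/homotopicP.
exists (l \o h \o (fun z => (k z.1, z.2))); split => [z|x|x] /=;
  rewrite ?h0 ?h1 //.
apply: continuous_comp; last by apply: continuous_comp; [exact: hc|exact: lc].
apply: continuous_pair => /=; last exact: continuous_snd.
by apply: (@continuous_comp _ _ _ fst k); [exact: continuous_fst|exact: kc].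
Qed.

(** The two homotopies are run at double speed and glued along the closed
sets t <= 1/2 and t >= 1/2. *)
Lemma homotopic_trans (X Y : topologicalType) (f g k : X -> Y) :
  homotopic R f g -> homotopic R g k -> homotopic R f k.
Proof.
move=> /homotopicP[h [hc h0 h1]] /homotopicP[l [lc l0 l1]].
pose a := h \o (fun z : X * R => (z.1, 2 * z.2)).
pose b := l \o (fun z : X * R => (z.1, 2 * z.2 - 1)).
have dc : continuous (fun z : X * R => 2 * z.2).
  by move=> z; apply: (@cvgM R _ (nbhs z) _ (cst 2) snd);
    [exact: cvg_cst|exact: continuous_snd].
have ac : continuous a.
  move=> z; apply: continuous_comp; last exact: hc.
  by apply: continuous_pair; [exact: continuous_fst|exact: dc].
have bc : continuous b.
  move=> z; apply: continuous_comp; last exact: lc.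
  apply: continuous_pair; first exact: continuous_fst.
  by apply: (@cvgB R _ _ (nbhs z)); [exact: dc|exact: cvg_cst].
pose c (z : X * R) := if z.2 <= 2^-1 then a z else b z.
have snd_c : continuous (snd : X * R -> R) by move=> z; exact: continuous_snd.
apply/homotopicP; exists c; split.
- apply/continuous_subspace_setT.
  have -> : [set: X * R] =
      (snd @^-1` [set t | t <= 2^-1]) `|` (snd @^-1` [set t | t >= 2^-1]).
    apply/seteqP; split=> // z _ /=.
    by case: (lerP z.2 2^-1) => [?|/ltW ?]; [left|right].
  apply: withinU_continuous.
  + by apply: preimage_closed => //; exact: closed_le.
  + by apply: preimage_closed => //; exact: closed_ge.
  + apply: (@subspace_eq_continuous _ _ _ a).
      by move=> z; rewrite inE /from_subspace /c /= => ->.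
    exact: continuous_subspaceT.
  + apply: (@subspace_eq_continuous _ _ _ b).
      move=> z; rewrite inE /from_subspace /c /= => z1; case: lerP => // z2.
      have e : z.2 = 2^-1 by apply: le_anti; rewrite z1 z2.
      by rewrite /a /b /= e mulfV ?subrr ?l0 ?h1 // pnatr_eq0.
    exact: continuous_subspaceT.
- by move=> x; rewrite /c /= invr_ge0 ler0n /a /= mulr0.
- move=> x; rewrite /c /=; case: lerP => [|_].
    by rewrite invf_ge1 ?ltr0n // lern1.
  by rewrite /b /= mulr1 -[2]/(1 + 1) addrK.
Qed.

Lemma homotopy_equivalent_sym (X Y : topologicalType) :
  homotopy_equivalent R X Y -> homotopy_equivalent R Y X.
Proof. by move=> [f [g [fc gc gf fg]]]; exists g, f. Qed.

Lemma homotopy_equivalent_trans (X Y Z : topologicalType) :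
  homotopy_equivalent R X Y -> homotopy_equivalent R Y Z ->
  homotopy_equivalent R X Z.
Proof.
move=> [f [g [fc gc gf fg]]] [f' [g' [fc' gc' gf' fg']]].
exists (f' \o f), (g \o g'); split.
- by move=> x; apply: continuous_comp; [exact: fc|exact: fc'].
- by move=> x; apply: continuous_comp; [exact: gc'|exact: gc].
- by apply: homotopic_trans gf; exact: (homotopic_comp fc gc gf').
- by apply: homotopic_trans fg'; exact: (homotopic_comp gc' fc' fg).
Qed.

End Topology.

(** * Homotopies along segments *)

Section Line.
Context (R : realType).
Local Notation vec T := {ptws T -> R}.

Definition line (T : finType) (x y : vec T) (t : R) : vec T :=
  fun i => x i + t * (y i - x i).

Definition in_set_type (X : Type) (A : set X) (x : X) (Ax : A x) : set_type A :=
  exist (fun x => x \in A) x (mem_set Ax).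

Lemma homotopic_line (X : topologicalType) (T : finType) (A : set (vec T))
    (f g : X -> set_type A) :
  continuous f -> continuous g ->
  (forall z t, 0 <= t <= 1 -> A (line (set_val (f z)) (set_val (g z)) t)) ->
  homotopic R f g.
Proof.
move=> fc gc Al; apply/homotopicP.
pose h (z : X * R) : set_type A :=
  in_set_type (Al z.1 (clamp z.2) (clamp_itv z.2)).
have coord (k : X -> set_type A) i : continuous k ->
    continuous (fun z : X * R => (set_val (k z.1) : vec T) i).
  move=> kc z; apply: (@continuous_comp _ _ _ (fun z : X * R =>
    set_val (k z.1) : vec T) (fun x => x i) z); last exact: continuous_coord.
  apply: continuous_comp; last exact: initial_continuous.
  by apply: continuous_comp; [exact: continuous_fst|exact: kc].
exists h; split=> [|x|x].
- apply: continuous_set_type => z; apply: continuous_ptws => i.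
  apply: (@cvgD _ _ _ (nbhs z)); first exact: coord.
  apply: (@cvgM _ _ (nbhs z) _ (fun z => clamp z.2)).
    apply: (@continuous_comp _ _ _ snd (@clamp R) z);
      first exact: continuous_snd.
    exact: continuous_clamp.
  by apply: (@cvgB _ _ _ (nbhs z)); exact: coord.
- apply: val_inj => /=; apply/funext => i.
  by rewrite /line clamp_id ?mul0r ?addr0 // lexx ler01.
- apply: val_inj => /=; apply/funext => i.
  by rewrite /line clamp_id ?mul1r ?subrKC // lexx ler01.
Qed.

Section Maps.
Variables (S T : finType) (A : set (vec S)) (B : set (vec T)).
Variable f : vec S -> vec T.
Hypothesis fAB : forall x, A x -> B (f x).

Definition set_type_map (z : set_type A) : set_type B :=
  in_set_type (fAB (set_valP z)).

Lemma continuous_set_type_map :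
  (forall x, A x -> forall i, {for x, continuous (fun x => f x i)}) ->
  continuous set_type_map.
Proof.
move=> fc; apply: continuous_set_type => z.
apply: (@continuous_comp _ _ _ (set_val : set_type A -> vec S) f).
  exact: initial_continuous.
by apply: continuous_ptws => i; apply: fc; exact: set_valP.
Qed.

End Maps.

(** The form in which cones are compared: what is left of the topology is the
continuity of coordinates at the points of the two sets, and a homotopy only has
to be checked to stay in its set. *)
Lemma line_equivalence (S T : finType) (A : set (vec S)) (B : set (vec T))
    (f : vec S -> vec T) (g : vec T -> vec S) :
  (forall x, A x -> B (f x)) -> (forall y, B y -> A (g y)) ->
  (forall x, A x -> forall i, {for x, continuous (fun x => f x i)}) ->
  (forall y, B y -> forall i, {for y, continuous (fun y => g y i)}) ->
  (forall x t, A x -> 0 <= t <= 1 -> A (line (g (f x)) x t)) ->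
  (forall y t, B y -> 0 <= t <= 1 -> B (line (f (g y)) y t)) ->
  homotopy_equivalent R (set_type A) (set_type B).
Proof.
move=> fAB gBA fc gc Al Bl.
have fcont := continuous_set_type_map (fAB := fAB) fc.
have gcont := continuous_set_type_map (fAB := gBA) gc.
exists (set_type_map fAB), (set_type_map gBA); split=> //.
- apply: homotopic_line => [z||z t t01]; [|by move=> z; exact: cvg_id|].
    by apply: continuous_comp; [exact: fcont|exact: gcont].
  by apply: Al => //; exact: set_valP.
- apply: homotopic_line => [z||z t t01]; [|by move=> z; exact: cvg_id|].
    by apply: continuous_comp; [exact: gcont|exact: fcont].
  by apply: Bl => //; exact: set_valP.
Qed.

Lemma star_shaped_contractible (T : finType) (A : set (vec T)) (p : vec T) :
  A p -> (forall x t, A x -> 0 <= t <= 1 -> A (line p x t)) ->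
  homotopy_equivalent R (set_type A) (one_point R).
Proof.
move=> Ap Al.
exists (fun=> in_set_type (erefl (0 : R) : [set (0 : R)] 0)).
exists (fun=> in_set_type Ap); split.
- exact: cst_continuous.
- exact: cst_continuous.
- apply: homotopic_line => [||z t t01]; first exact: cst_continuous.
    by move=> z; exact: cvg_id.
  by apply: Al => //; exact: set_valP.
- apply/homotopicP; exists fst; split=> //=; first exact: continuous_fst.
  by move=> x; apply: val_inj; rewrite /= (set_valP x).
Qed.

(** The map f is not asked to fix the points of B: it is enough that B
contains the segments from its points to their images. *)
Lemma line_retract (T : finType) (A B : set (vec T)) (f : vec T -> vec T) :
  (forall x, B x -> A x) -> (forall x, A x -> B (f x)) ->
  (forall x, A x -> forall i, {for x, continuous (fun x => f x i)}) ->
  (forall x t, A x -> 0 <= t <= 1 -> A (line (f x) x t)) ->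
  (forall x t, B x -> 0 <= t <= 1 -> B (line (f x) x t)) ->
  homotopy_equivalent R (set_type A) (set_type B).
Proof.
move=> BA fAB fc Al Bl; apply: (@line_equivalence _ _ _ _ f id) => // y By i.
exact: continuous_coord.
Qed.
End Line.

(** * Cones of sign patterns, and spheres *)

Section Cone.
Context (R : realType).
Local Notation vec T := {ptws T -> R}.

Lemma line_id (T : finType) (x : vec T) t : line x x t = x.
Proof. by apply/funext => i; rewrite /line subrr mulr0 addr0. Qed.

Definition pos_supp (T : finType) (x : vec T) : {set T} :=
  [set i | 0 < x i]%SET.
Definition neg_supp (T : finType) (x : vec T) : {set T} :=
  [set i | x i < 0]%SET.

(** A cone on the realization of the complex of disjoint pairs (a, b) with a
in A and b in B, apex removed: x stands for the pair formed by its positive and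
its negative support. *)
Definition cone (T : finType) (A B : {set {set T}}) : set (vec T) :=
  [set x | [/\ pos_supp x \in A, neg_supp x \in B & exists i, x i != 0]].

Lemma sum_gt0 (T : finType) (F : T -> R) i :
  (forall j, 0 <= F j) -> F i != 0 -> 0 < \sum_j F j.
Proof.
move=> F0 Fi; rewrite lt_neqAle sumr_ge0 ?andbT; last by move=> *.
by rewrite eq_sym psumr_neq0; [apply/hasP; exists i;
  rewrite ?mem_index_enum //= lt_neqAle eq_sym Fi F0|move=> *].
Qed.

Lemma continuous_sum (X : topologicalType) (T : finType)
    (F : T -> X -> R) (x : X) :
  (forall j, {for x, continuous (F j)}) ->
  {for x, continuous (fun y => \sum_j F j y)}.
Proof.
move=> Fc; apply: (@cvg_big _ _ +%R 0 xpredT _ _ (nbhs x)) => //;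
  last by move=> i _; exact: Fc.
exact: add_continuous.
Qed.

Lemma continuous_row (X : topologicalType) n (f : X -> 'rV[R]_n) (x : X) :
  (forall j, {for x, continuous (fun y => f y ord0 j)}) ->
  {for x, continuous f}.
Proof.
move=> fc U [P Pn PU].
have xP : \forall y \near x, forall j, P ord0 j (f y ord0 j).
  by apply: filter_forall => j; exact: (fc j _ (Pn ord0 j)).
change (nbhs x (f @^-1` U)).
by apply: filterS xP => y Py; apply: PU => i j; rewrite ord1.
Qed.

Lemma sphere_vec n : homotopy_equivalent R
  (set_type [set x : vec 'I_n | \sum_j x j ^+ 2 = 1])
  (set_type [set x : 'rV[R]_n | \sum_j x ord0 j ^+ 2 = 1]).
Proof.
set A := [set x : vec _ | _]; set B := [set x | _].
have fP (x : set_type A) : B (\row_j (set_val x : vec _) j).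
  by rewrite /B /= -[RHS](set_valP x); apply: eq_bigr => j _; rewrite mxE.
have gP (x : set_type B) : A (fun j => set_val x ord0 j) by exact: (set_valP x).
have idh (X : topologicalType) (k : X -> X) : k =1 id -> homotopic R k id.
  move=> k1; apply/homotopicP; exists fst; split=> //=;
    first exact: continuous_fst.
exists (fun x => in_set_type (fP x)), (fun x => in_set_type (gP x)); split.
- apply: continuous_set_type => x; apply: continuous_row => j.
  rewrite (_ : (fun y => _) = (fun y => (set_val y : vec 'I_n) j)); last first.
    by apply/funext => y; rewrite /= mxE.
  apply: (@continuous_comp _ _ _ (fun y : set_type A => set_val y : vec 'I_n)
    (fun z => z j)); [exact: initial_continuous|exact: continuous_coord].
- apply: continuous_set_type => x; apply: continuous_ptws => i /=.
  apply: (@continuous_comp _ _ _ (fun y : set_type B => set_val y : 'rV[R]_n)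
    (fun z => z ord0 i)); [exact: initial_continuous|exact: coord_continuous].
- by apply: idh => x; apply: val_inj; apply/funext => j /=; rewrite mxE.
- by apply: idh => x; apply: val_inj; apply/rowP => j /=; rewrite mxE.
Qed.

Lemma cone_line_scale (T : finType) (A B : {set {set T}}) (x : vec T) k t :
  cone A B x -> 0 < k -> 0 <= t <= 1 -> cone A B (line (fun i => k * x i) x t).
Proof.
move=> [xA xB [i xi]] k0 t01; set c := k + t * (1 - k).
have c0 : 0 < c by rewrite /c; nra.
have lE j : line (fun i => k * x i) x t j = c * x j by rewrite /line /c; ring.
split; last by exists i; rewrite lE mulf_neq0 // gt_eqF.
- by rewrite (_ : pos_supp _ = pos_supp x) //; apply/setP => j;
    rewrite !inE lE pmulr_rgt0.
- by rewrite (_ : neg_supp _ = neg_supp x) //; apply/setP => j;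
    rewrite !inE lE pmulr_rlt0.
Qed.

Lemma cone_powersetP (T : finType) (A : {set T}) (x : vec T) :
  cone (powerset A) (powerset A) x <->
  (forall i, i \notin A -> x i = 0) /\ exists i, x i != 0.
Proof.
split=> [[xA xB xn]|[xA xn]].
  split=> // i iA; apply/eqP; case: ltgtP => // xi; case/negP: iA.
    by move: xB; rewrite powersetE => /fintype.subsetP; apply; rewrite inE.
  by move: xA; rewrite powersetE => /fintype.subsetP; apply; rewrite inE.
split=> //; rewrite powersetE; apply/fintype.subsetP => i; rewrite inE;
  by apply: contraTT => /xA ->; rewrite ltxx.
Qed.

(** All sign patterns on A are allowed here, so this is a coordinate space
without its origin, and normalization retracts it onto the unit sphere. *)
Lemma cone_sphere (T : finType) (A : {set T}) (n : int) :
  absz (n + 1) = #|A| ->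
  homotopy_equivalent R
    (set_type (cone (powerset A) (powerset A))) (sphere R n).
Proof.
rewrite /sphere => ->.
apply: homotopy_equivalent_trans (sphere_vec _).
pose N (x : vec T) := \sum_i x i ^+ 2.
pose f (x : vec T) : vec 'I_#|A| := fun j =>
  (Num.sqrt (N x))^-1 * x (enum_val j).
pose g (y : vec 'I_#|A|) : vec T := fun i => \sum_j (enum_val j == i)%:R * y j.
have gE y (j : 'I_#|A|) : g y (enum_val j) = y j.
  rewrite /g (bigD1 j) //= eqxx mul1r big1 ?addr0 // => k kj.
  by rewrite (inj_eq enum_val_inj) (negbTE kj) mul0r.
have g0 y i : i \notin A -> g y i = 0.
  move=> iA; rewrite /g big1 // => j _; case: eqP => [ij|];
    last by rewrite mul0r.
  by rewrite -ij enum_valP in iA.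
have N0 x : cone (powerset A) (powerset A) x -> 0 < N x.
  move=> [_ _ [i xi]]; apply: (@sum_gt0 _ _ i); last by rewrite sqrf_eq0.
  by move=> j; exact: sqr_ge0.
have s0 x : cone (powerset A) (powerset A) x -> 0 < Num.sqrt (N x).
  by move=> /N0 ?; rewrite sqrtr_gt0.
have gf x : cone (powerset A) (powerset A) x ->
    g (f x) = (fun i => (Num.sqrt (N x))^-1 * x i).
  move=> /cone_powersetP[x0 _]; apply/funext => i.
  case: (boolP (i \in A)) => iA; last by rewrite g0 // x0 // mulr0.
  by rewrite -(enum_rankK_in iA iA) gE.
have fg y : \sum_j y j ^+ 2 = 1 -> f (g y) = y.
  move=> y1; apply/funext => j;
    rewrite /f gE (_ : N _ = 1) ?sqrtr1 ?invr1 ?mul1r //.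
  rewrite /N (bigID (mem A)) /= [X in _ + X]big1 ?addr0; last first.
    by move=> i /g0 ->; rewrite expr0n.
  by rewrite big_enum_val /= -[RHS]y1; apply: eq_bigr => k _; rewrite gE.
apply: (@line_equivalence _ _ _ _ _ f g).
- move=> x cx; rewrite /= /f; under eq_bigr do rewrite exprMn.
  rewrite -mulr_sumr exprVn sqr_sqrtr ?ltW ?N0 //.
  rewrite -(big_enum_val (fun i => x i ^+ 2)) /=.
  rewrite -[X in _ * X](_ : N x = _) ?mulVf ?gt_eqF ?N0 //.
  rewrite /N (bigID (mem A)) /= [X in _ + X]big1 ?addr0 // => i iA.
  by case/cone_powersetP: cx => -> //; rewrite expr0n.
- move=> y /= y1; apply/cone_powersetP; split=> [i|]; first exact: g0.
  apply: contrapT => y0; have /eqP := y1; rewrite big1 ?(eq_sym 0) ?oner_eq0 //.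
  move=> j _; apply/eqP; rewrite sqrf_eq0 -gE; apply/negP => /negP yj;
    apply: y0.
  by exists (enum_val j).
- move=> x cx j; apply: (@cvgM _ _ (nbhs x)); last exact: continuous_coord.
  apply: cvgV; first by rewrite gt_eqF // s0.
  apply: (@continuous_comp _ _ _ N Num.sqrt); last exact: sqrt_continuous.
  apply: continuous_sum => i.
  by apply: (@cvgM _ _ (nbhs x)); exact: continuous_coord.
- move=> y _ i; apply: continuous_sum => j.
  by apply: (@cvgM _ _ (nbhs y)); [exact: cvg_cst|exact: continuous_coord].
- by move=> x t cx t01; rewrite gf //; apply: cone_line_scale => //;
    rewrite invr_gt0 s0.
- by move=> y t /= y1 _; rewrite fg // line_id.
Qed.
End Cone.

(** * The threshold of a complex *)

Section Threshold.
Context (R : realType) (T : finType).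
Local Notation vec := {ptws T -> R}.
Variables (K : {set {set T}}) (A : {set T}).

(** The largest t that can be added to the coordinates in A while the set of
the positive ones remains a face of K. *)
Definition threshold (x : vec) : R :=
  xget 0 [set t | [set i in A | 0 < x i + t]%SET \in K /\
                  [set i in A | 0 <= x i + t]%SET \notin K].

Hypotheses (cK : simplicial_complex K) (AK : A \notin K).

(** Among the values - x i for i in A at which the nonnegative coordinates
fail to form a face, take the least. If the positive coordinates failed as well,
the smallest of them would give a lesser value. *)
Lemma thresholdP (x : vec) :
  [set i in A | 0 < x i + threshold x]%SET \in K /\
  [set i in A | 0 <= x i + threshold x]%SET \notin K.
Proof.
have [K0 Kd] := cK.
have notK (s t : {set T}) : s \subset t -> s \notin K -> t \notin K.
  by move=> st; apply: contraNN => tK; exact: Kd tK st.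
suff : exists t, [set i in A | 0 < x i + t]%SET \in K /\
    [set i in A | 0 <= x i + t]%SET \notin K.
  by move=> tP; exact: (@xgetPex R 0 _ tP).
(* The candidates for the threshold are the values - x i with P i. *)
pose P i := (i \in A) && ([set j in A | 0 <= x j - x i]%SET \notin K).
have PN (F : {set T}) : F \subset A -> F \notin K -> exists2 i, i \in F & P i.
  move=> FA FK; have [i0 iF] : exists i, i \in F.
    by apply/set0Pn; apply: contraNneq FK => ->.
  case: (@arg_minP _ _ _ i0 (mem F) x iF) => i iF' imin; exists i => //.
  rewrite /P (fintype.subsetP FA) //=; apply: notK FK;
    apply/fintype.subsetP => j jF.
  by rewrite inE (fintype.subsetP FA) //= subr_ge0 imin.
have [i0 _ Pi0] := PN A (fintype.subxx _) AK.
case: (@arg_maxP _ _ _ i0 P x Pi0) => i Pi imax; exists (- x i).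
case/andP: (Pi) => iA iK; split=> //; apply: contraT => nK.
have [|j] := PN _ _ nK; first by apply/fintype.subsetP => j;
  rewrite inE => /andP[].
by rewrite inE subr_gt0 => /andP[_ xij] /imax /=; rewrite leNgt xij.
Qed.

Lemma le_threshold (x : vec) t :
  [set i in A | 0 < x i + t]%SET \in K -> t <= threshold x.
Proof.
move=> tK; rewrite leNgt; apply/negP => xt; case: (thresholdP x) => _ /negP;
  apply.
apply: (cK.2 _ _ tK); apply/fintype.subsetP => i;
  rewrite !inE => /andP[-> h] /=.
by apply: le_lt_trans h _; rewrite ltrD2l.
Qed.

Lemma threshold_le (x : vec) t :
  [set i in A | 0 <= x i + t]%SET \notin K -> threshold x <= t.
Proof.
move=> tK; rewrite leNgt; apply: contra tK => xt.
apply: (cK.2 _ _ (thresholdP x).1); apply/fintype.subsetP => i;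
  rewrite !inE => /andP[-> h] /=.
by apply: le_lt_trans h _; rewrite ltrD2l.
Qed.

Lemma threshold_shift (x y : vec) s : {in A, forall i, y i = x i + s} ->
  threshold y = threshold x - s.
Proof.
move=> yx; have [h1 h2] := thresholdP x; apply: le_anti; apply/andP; split.
  apply: threshold_le; rewrite (_ : [set i in A | _]%SET =
    [set i in A | 0 <= x i + threshold x]%SET) //.
  apply/setP => i; rewrite !inE; case: (boolP (i \in A)) => //= iA;
    rewrite yx //.
  by rewrite addrACA subrr addr0.
apply: le_threshold; rewrite (_ : [set i in A | _]%SET =
  [set i in A | 0 < x i + threshold x]%SET) //.
apply/setP => i; rewrite !inE; case: (boolP (i \in A)) => //= iA; rewrite yx //.
by rewrite addrACA subrr addr0.
Qed.

(** If every coordinate moves by at most e from x to y and t is the threshold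
of x, then y i + (t - e) > 0 forces x i + t > 0, so the threshold of y is at
least t - e. This gives continuity without a formula for the threshold. *)
Lemma threshold_lipschitz (x y : vec) e : (forall i, `|x i - y i| <= e) ->
  `|threshold x - threshold y| <= e.
Proof.
have half u v : (forall i, `|u i - v i| <= e) -> threshold u - e <= threshold v.
  move=> uv; apply: le_threshold; apply: (cK.2 _ _ (thresholdP u).1).
  apply/fintype.subsetP => i; rewrite !inE => /andP[-> h] /=.
  by have := uv i; rewrite ler_norml => /andP[]; lra.
move=> xy; have h1 := half _ _ xy.
have h2 : threshold y - e <= threshold x by apply: half => i; rewrite distrC.
by rewrite ler_norml; lra.
Qed.

Lemma continuous_threshold_comp (X : topologicalType) (f : X -> vec) (x : X) :
  (forall i, {for x, continuous (fun y => f y i)}) ->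
  {for x, continuous (fun y => threshold (f y))}.
Proof.
move=> fc; apply/cvgrPdist_le => e e0.
have near_e : \forall y \near x, forall i, `|f x i - f y i| <= e.
  apply: filter_forall => i; have := fc i.
  by move/cvgrPdist_le; apply.
by apply: filterS near_e => y; exact: threshold_lipschitz.
Qed.

Lemma continuous_threshold (x : vec) : {for x, continuous threshold}.
Proof.
by apply: (@continuous_threshold_comp _ id x) => i; exact: continuous_coord.
Qed.

End Threshold.

(** * Restricted complexes and contractible cones *)

Section Cones.
Context (R : realType) (T : finType).
Local Notation vec := {ptws T -> R}.
Implicit Types (K L : {set {set T}}) (I J : {set T}) (x : vec).

Lemma complex_full K I : simplicial_complex K ->
  simplicial_complex (full_subcomplex K I).
Proof.
move=> [K0 Kd]; split; first by rewrite inE K0 finset.sub0set.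
move=> s t; rewrite !inE => /andP[tK tI] st; rewrite (Kd _ _ tK st).
exact: fintype.subset_trans st tI.
Qed.

Lemma complex_powerset I : simplicial_complex (powerset I).
Proof.
split=> [|s t]; first by rewrite powersetE finset.sub0set.
by rewrite !powersetE => tI st; exact: fintype.subset_trans st tI.
Qed.

Lemma full_powerset K I : simplicial_complex K -> I \in K ->
  full_subcomplex K I = powerset I.
Proof.
move=> [_ Kd] IK; apply/setP => s; rewrite inE powersetE andb_idl //.
exact: Kd.
Qed.

(** This symmetry exchanges the two complexes, so that only one of the two
inclusions between I and J has to be studied. *)
Lemma cone_opp K L : homotopy_equivalent R (set_type (@cone R T K L))
  (set_type (@cone R T L K)).
Proof.
pose opp (x : vec) : vec := fun i => - x i.
have oppK x : opp (opp x) = x by apply/funext => i; rewrite /opp opprK.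
have opp_cone A B x : cone A B x -> cone B A (opp x).
  move=> [xA xB [i xi]]; split; last by exists i; rewrite oppr_eq0.
    by rewrite (_ : pos_supp _ = neg_supp x) //; apply/setP => j;
      rewrite !inE oppr_gt0.
  by rewrite (_ : neg_supp _ = pos_supp x) //; apply/setP => j;
    rewrite !inE oppr_lt0.
have oppc x i : {for x, continuous (fun x => opp x i)}.
  by apply: continuousN; exact: continuous_coord.
apply: (@line_equivalence _ _ _ _ _ opp opp) => [|||| x t xc _ | x t xc _].
- exact: opp_cone.
- exact: opp_cone.
- by move=> x _ i.
- by move=> x _ i.
- by rewrite oppK line_id.
- by rewrite oppK line_id.
Qed.

(** The cone is star-shaped about the indicator p of I. Moving towards p only
removes negative coordinates, and a segment ending in p meets 0 only if it
starts at a negative multiple of p, whose negative support I is not in L. *)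
Lemma cone_powerset_contractible I L : simplicial_complex L -> I \notin L ->
  homotopy_equivalent R (set_type (@cone R T (powerset I) L)) (one_point R).
Proof.
move=> [L0 Ld] IL; pose p : vec := fun i => (i \in I)%:R.
have [i0 i0I] : exists i, i \in I by apply/set0Pn; apply: contraNneq IL => ->.
apply: (star_shaped_contractible (p := p)) =>
  [|x t [xI xL [i xi]] /andP[t0 t1]].
  split; last by exists i0; rewrite /p i0I oner_eq0.
    rewrite powersetE; apply/fintype.subsetP => i; rewrite inE /p.
    by case: (i \in I) => //; rewrite ltxx.
  rewrite (_ : neg_supp _ = finset.set0) //; apply/setP => i; rewrite !inE /p.
  by apply/negbTE; rewrite -leNgt ler0n.
have p0 j : 0 <= p j by rewrite ler0n.
split.
- rewrite powersetE; apply/fintype.subsetP => j; rewrite inE /line.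
  apply: contraLR => jI; rewrite /p (negbTE jI) add0r subr0 -leNgt.
  apply: mulr_ge0_le0 => //; rewrite leNgt; apply: contra jI => xj.
  by move: xI; rewrite powersetE => /fintype.subsetP; apply; rewrite inE.
- apply: Ld xL _; apply/fintype.subsetP => j; rewrite !inE /line.
  by have := p0 j; nra.
- apply: contrapT => z0; have zero j : line p x t j = 0.
    by apply: contrapT => /eqP zj; apply: z0; exists j.
  have t_neq0 : t != 0.
    apply/negP => /eqP te; have := zero i0.
    by rewrite /line te mul0r addr0 /p i0I => /eqP; rewrite oner_eq0.
  have t_neq1 : t != 1.
    by apply/negP => /eqP te; have := zero i; rewrite /line te mul1r subrKC;
      exact/eqP.
  have tp : 0 < t by rewrite lt_neqAle eq_sym t_neq0.
  have tl : t < 1 by rewrite lt_neqAle t_neq1.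
  case/negP: IL; apply: Ld xL _; apply/fintype.subsetP => j jI; rewrite inE.
  by have := zero j; rewrite /line /p jI /=; nra.
Qed.

Lemma powerset_cone_contractible J K : simplicial_complex K -> J \notin K ->
  homotopy_equivalent R (set_type (@cone R T K (powerset J))) (one_point R).
Proof.
move=> cK JK; apply: homotopy_equivalent_trans (cone_opp _ _) _.
exact: cone_powerset_contractible.
Qed.

End Cones.

(** * Raising coordinates to the threshold *)

Section Raise.
Context (R : realType) (T : finType).
Local Notation vec := {ptws T -> R}.
Implicit Types (K L : {set {set T}}) (I J : {set T}) (x : vec).

Definition raise I (c : R) x : vec := fun i => x i + (i \in I)%:R * c.

Lemma line_raise I c x t : line (raise I c x) x t = raise I ((1 - t) * c) x.
Proof. by apply/funext => i; rewrite /line /raise; ring. Qed.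

Lemma neg_raise I c x : 0 <= c -> neg_supp (raise I c x) \subset neg_supp x.
Proof.
move=> c0; apply/fintype.subsetP => i; rewrite !inE /raise.
by apply: contraLR; rewrite -!leNgt => xi; rewrite addr_ge0 // mulr_ge0.
Qed.

Variables (K L : {set {set T}}) (I J : {set T}).
Hypotheses (cK : simplicial_complex K) (cL : simplicial_complex L).
Hypothesis dualKL : forall s, (s \in L) = (~: s \notin K).
Hypothesis IK : I \notin K.

Lemma threshold_ge0 x :
  pos_supp x \in full_subcomplex K I -> 0 <= threshold K I x.
Proof.
rewrite inE => /andP[xK xI]; apply: (le_threshold cK IK).
rewrite (_ : [set i in I | _]%SET = pos_supp x) //; apply/setP => i.
rewrite !inE addr0 andb_idl // => xi.
by move/fintype.subsetP : xI; apply; rewrite inE.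
Qed.

Lemma pos_raise c x : pos_supp x \subset I -> c <= threshold K I x ->
  pos_supp (raise I c x) \in full_subcomplex K I.
Proof.
move=> /fintype.subsetP xI cx.
have posI : pos_supp (raise I c x) \subset I.
  apply/fintype.subsetP => i; rewrite inE /raise; apply: contraLR => iI.
  rewrite (negbTE iI) mul0r addr0 -leNgt leNgt; apply: contra iI => xi.
  by apply: xI; rewrite inE.
rewrite inE posI andbT; apply: (cK.2 _ _ (thresholdP cK IK x).1).
apply/fintype.subsetP => i ix; have iI := fintype.subsetP posI i ix.
move: ix; rewrite !inE /raise iI mul1r /= => h; apply: lt_le_trans h _.
by rewrite lerD2l.
Qed.

(** This is where duality enters: the complement of the negative support
contains the nonnegative coordinates in I, which at the threshold are not a face
of K. *)
Lemma neg_raise_threshold x : neg_supp (raise I (threshold K I x) x) \in L.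
Proof.
rewrite dualKL; apply: contra (thresholdP cK IK x).2 => h; apply: (cK.2 _ _ h).
apply/fintype.subsetP => i; rewrite !inE /raise => /andP[-> h'].
by rewrite mul1r -leNgt.
Qed.

Lemma continuous_raise_threshold x i :
  {for x, continuous (fun x => raise I (threshold K I x) x i)}.
Proof.
apply: (@cvgD _ _ _ (nbhs x)); first exact: continuous_coord.
apply: (@cvgM _ _ (nbhs x)); first exact: cvg_cst.
exact: continuous_threshold.
Qed.

Local Notation KI := (full_subcomplex K I).
Local Notation LJ := (full_subcomplex L J).

(** Raising to the threshold restores the condition on the negative support.
A coordinate in I outside J is nonnegative on both cones, and becomes positive
when it is raised, so that the path avoids 0. *)
Lemma cone_retract_up : ~~ (I \subset J) ->
  homotopy_equivalent R (set_type (@cone R T KI (powerset J)))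
    (set_type (@cone R T KI LJ)).
Proof.
move=> /subsetPn[i0 i0I i0J].
have raise_neq0 c x : neg_supp x \subset J -> 0 <= c -> (exists i, x i != 0) ->
    exists i, raise I c x i != 0.
  move=> xJ c0 [i xi]; have [ce|cn] := eqVneq c 0.
    by exists i; rewrite /raise ce mulr0 addr0.
  exists i0; rewrite /raise i0I mul1r gt_eqF //.
  have x0 : 0 <= x i0.
    rewrite leNgt; apply: contra i0J => xi0.
    by apply: (fintype.subsetP xJ); rewrite inE.
  by rewrite ltr_wpDl // lt_neqAle eq_sym cn.
apply: (line_retract (f := fun x => raise I (threshold K I x) x)) =>
  [x|x|x _ i|x t|x t].
- by move=> [xK]; rewrite inE => /andP[_ xJ] xn; split=> //; rewrite powersetE.
- move=> [xK]; rewrite powersetE => xJ xn; have x0 := threshold_ge0 xK.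
  split; last exact: raise_neq0.
    by apply: pos_raise => //; move: xK; rewrite inE => /andP[].
  by rewrite inE neg_raise_threshold (fintype.subset_trans (neg_raise _ _ _)).
- exact: continuous_raise_threshold.
- move=> [xK]; rewrite powersetE => xJ xn /andP[t0 t1];
    have x0 := threshold_ge0 xK.
  have c0 : 0 <= (1 - t) * threshold K I x by nra.
  rewrite line_raise; split; last exact: raise_neq0.
    by apply: pos_raise; [move: xK; rewrite inE => /andP[]|nra].
  by rewrite powersetE (fintype.subset_trans (neg_raise _ _ _)).
- move=> [xK]; rewrite inE => /andP[xL xJ] xn /andP[t0 t1];
    have x0 := threshold_ge0 xK.
  have c0 : 0 <= (1 - t) * threshold K I x by nra.
  rewrite line_raise; split; last exact: raise_neq0.
    by apply: pos_raise; [move: xK; rewrite inE => /andP[]|nra].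
  rewrite inE (cL.2 _ _ xL) ?neg_raise //=.
  by rewrite (fintype.subset_trans (neg_raise _ _ _)).
Qed.

(** The quotient of R^I by the line of the indicator of I is realized by the
hyperplane where x i0 = 0. The projection does not kill any vector of the cone:
on a multiple of the indicator, I would be the positive or the negative support.
Raising to the threshold is a section, and it is joined to the identity within
the fibres. *)
Lemma cone_diagonal i0 : i0 \in I -> I \notin L ->
  homotopy_equivalent R (set_type (@cone R T KI (full_subcomplex L I)))
    (set_type (@cone R T (powerset (I :\ i0)) (powerset (I :\ i0)))).
Proof.
move=> i0I IL.
have zeroP A B x : cone (full_subcomplex A I) (full_subcomplex B I) x ->
    forall i, i \notin I -> x i = 0.
  move=> [xA xB _] i iI; apply/eqP; case: ltgtP => // xi; case/negP: iI.
    by move: xB; rewrite inE => /andP[_ /fintype.subsetP]; apply; rewrite inE.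
  by move: xA; rewrite inE => /andP[_ /fintype.subsetP]; apply; rewrite inE.
pose f (x : vec) := raise I (- x i0) x.
pose g (y : vec) := raise I (threshold K I y) y.
have raise_raise c d x : raise I c (raise I d x) = raise I (c + d) x.
  by apply/funext => i; rewrite /raise; ring.
have raise0 x : raise I 0 x = x by apply/funext => i; rewrite /raise; ring.
have gf x : g (f x) = raise I (threshold K I x) x.
  rewrite /g /f raise_raise (threshold_shift cK IK (x := x) (s := - x i0)).
    by rewrite opprK addrK.
  by move=> i iI; rewrite /raise iI mul1r.
have fg y : y i0 = 0 -> f (g y) = y.
  move=> y0; rewrite /f /g raise_raise (_ : _ + _ = 0) //.
  by rewrite /raise y0 i0I mul1r add0r addNr.
apply: (@line_equivalence _ _ _ _ _ f g) => [x|y|x _ i|y _ i|x t|y t].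
- move=> xc; have x0 := zeroP _ _ _ xc; case: xc => xK xL [i xi].
  apply/cone_powersetP; split=> [j|].
    rewrite !inE negb_and negbK => /orP[/eqP->|jI]; rewrite /f /raise.
      by rewrite i0I mul1r subrr.
    by rewrite x0 // (negbTE jI) mul0r addr0.
  apply: contrapT => z0; have zero j : j \in I -> x j = x i0.
    move=> jI; apply/eqP; rewrite -subr_eq0; apply: contrapT => /negP xj.
    by apply: z0; exists j; rewrite /f /raise jI mul1r.
  have iI : i \in I by apply: contraNT xi => /x0 ->.
  case: (ltgtP (x i0) 0) => xi0; last by rewrite zero // xi0 eqxx in xi.
    case/negP: IL; move: xL; rewrite inE => /andP[xL _]; apply: cL.2 xL _.
    by apply/fintype.subsetP => j jI; rewrite inE zero.
  case/negP: IK; move: xK; rewrite inE => /andP[xK _]; apply: cK.2 xK _.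
  by apply/fintype.subsetP => j jI; rewrite inE zero.
- move=> /cone_powersetP[y0 [i yi]].
  have y0' j : j \notin I -> y j = 0.
    by move=> jI; apply: y0; rewrite !inE negb_and jI orbT.
  split.
  + apply: pos_raise => //; apply/fintype.subsetP => j; rewrite inE.
    by apply: contraTT => /y0' ->; rewrite ltxx.
  + rewrite inE neg_raise_threshold /=; apply/fintype.subsetP => j; rewrite inE.
    by apply: contraTT => jI;
      rewrite /g /raise y0' // (negbTE jI) mul0r addr0 ltxx.
  + have [te|tn] := eqVneq (threshold K I y) 0; first by exists i;
      rewrite /g te raise0.
    by exists i0; rewrite /g /raise i0I mul1r y0 ?add0r // !inE eqxx.
- apply: (@cvgD _ _ _ (nbhs x)); first exact: continuous_coord.
  apply: (@cvgM _ _ (nbhs x)); first exact: cvg_cst.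
  by apply: continuousN; exact: continuous_coord.
- exact: continuous_raise_threshold.
- move=> [xK xL xn] /andP[t0 t1]; have x0 := threshold_ge0 xK;
    rewrite gf line_raise.
  have c0 : 0 <= (1 - t) * threshold K I x by nra.
  move: (xL); rewrite inE => /andP[xL' xI]; split.
  + by apply: pos_raise; [move: xK; rewrite inE => /andP[]|nra].
  + rewrite inE (cL.2 _ _ xL') ?neg_raise //=.
    by rewrite (fintype.subset_trans (neg_raise _ _ _)).
  + apply: contrapT => z0;
      have zero j : j \in I -> x j = - ((1 - t) * threshold K I x).
      move=> jI; apply/eqP; rewrite -addr_eq0; apply: contrapT => /negP xj.
      by apply: z0; exists j; rewrite /raise jI mul1r.
    have [te|tn] := eqVneq ((1 - t) * threshold K I x) 0.
      by apply: z0; rewrite te raise0.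
    case/negP: IL; apply: cL.2 xL' _; apply/fintype.subsetP => j jI.
    by rewrite inE zero // oppr_lt0 lt_neqAle eq_sym tn.
- move=> yc _; rewrite fg ?line_id //; case/cone_powersetP: (yc) => -> //.
  by rewrite !inE eqxx.
Qed.

End Raise.

(** * Retraction onto a closed star *)

Section LinkCone.
Context (R : realType) (T : finType).
Local Notation vec := {ptws T -> R}.
Variables (K : {set {set T}}) (I J : {set T}).
Hypotheses (cK : simplicial_complex K) (IK : I \notin K) (JK : J \in K).
Hypothesis JI : J \subset I.

Definition closed_star (K : {set {set T}}) : {set {set T}} :=
  [set s | s :|: J \in K]%SET.

Local Notation KI := (full_subcomplex K I).
Local Notation M := (closed_star KI).

Lemma complex_closed_star : simplicial_complex M.
Proof.
have [K0 Kd] := complex_full I cK; split; first by rewrite !inE finset.set0U JK.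
move=> s t tM st; rewrite inE; apply: Kd (finset.setSU _ st).
by rewrite inE in tM.
Qed.

Lemma closed_star_sub s : s \in M -> s \in KI.
Proof. by rewrite inE => h;
  apply: (complex_full I cK).2 h (finset.subsetUl _ _). Qed.

(** Lower all coordinates by the least c for which the positive support
enters the closed star of J, stopping at 0 outside J. If a vector x reached 0 on
the way, then it would be a positive constant on J; its positive support would
contain J and so already lie in the closed star, and c would be 0. *)
Lemma cone_retract_star :
  homotopy_equivalent R (set_type (@cone R T KI (powerset J)))
    (set_type (@cone R T M (powerset J))).
Proof.
have cM := complex_closed_star.
have IM : I \notin M by rewrite !inE negb_and (finset.setUidPl JI) IK.
(* The least c >= 0 such that the i in I with x i - c > 0 form a face of the
   closed star. *)
pose c (x : vec) : R := Num.max 0 (- threshold M I x).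
have c0 x : 0 <= c x by rewrite le_max lexx.
have cc x : {for x, continuous c}.
  apply: continuous_maxr; first exact: continuous_const.
  by apply: continuousN; exact: continuous_threshold.
have cE (x : vec) : pos_supp x \in M -> c x = 0.
  move=> xM; rewrite /c max_l // oppr_le0; apply: (le_threshold cM IM).
  apply: cM.2 xM _; apply/fintype.subsetP => i; rewrite !inE addr0.
  by case/andP.
pose d (x : vec) : vec := fun i =>
  if i \in J then x i - c x else Num.max 0 (x i - c x).
have nzP (x : vec) e : cone KI (powerset J) x -> 0 <= e ->
    (forall i, i \in J -> x i = e) -> e = 0 \/ c x = 0.
  move=> [xK _ _] e0 xJ; have [->|e1] := eqVneq e 0; [by left|right].
  apply: cE; rewrite inE (_ : _ :|: _ = pos_supp x) //; apply/finset.setUidPl.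
  apply/fintype.subsetP => j jJ; rewrite inE xJ //.
  by rewrite lt_neqAle eq_sym e1.
have outJ (x : vec) i : cone KI (powerset J) x -> i \notin J -> 0 <= x i.
  move=> [_ + _] iJ; rewrite powersetE => /fintype.subsetP xJ.
  by rewrite leNgt; apply: contra iJ => xi; apply: xJ; rewrite inE.
have line_cone (x : vec) t : cone KI (powerset J) x -> 0 <= t <= 1 ->
    cone KI (powerset J) (line (d x) x t).
  move=> xc /andP[t0 t1]; have [xK xL [i xi]] := xc; split.
  - apply: (complex_full I cK).2 xK _; apply/fintype.subsetP => j.
    rewrite !inE /line /d; have := c0 x; case: ifPn => jJ; first by nra.
    have := outJ _ _ xc jJ; set e := x j; set a := c x => e0 a0.
    by case: (leP 0 (e - a)) => ea; nra.
  - rewrite powersetE; apply/fintype.subsetP => j; rewrite inE.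
    apply: contraLR => jJ; rewrite -leNgt /line /d (negbTE jJ).
    have := outJ _ _ xc jJ; set e := x j; set a := c x => e0.
    by case: (leP 0 (e - a)) => ea; nra.
  - apply: contrapT => z0; have zero j : line (d x) x t j = 0.
      by apply: contrapT => /eqP zj; apply: z0; exists j.
    have : (1 - t) * c x = 0 \/ c x = 0.
      apply: nzP => // [|j jJ]; first by have := c0 x; nra.
      by have := zero j; rewrite /line /d jJ; lra.
    have zero_t : (1 - t) * c x = 0 -> line (d x) x t i = x i.
      rewrite /line /d; case: ifPn => iJ h; first by lra.
      have := outJ _ _ xc iJ => x0.
      have [ct|ct] : 1 - t = 0 \/ c x = 0.
        by move/eqP: h; rewrite mulf_eq0 => /orP[]/eqP; [left|right].
        by rewrite (_ : t = 1); [ring|lra].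
      by rewrite ct subr0 max_r //; ring.
    move=> h; have {}h : (1 - t) * c x = 0 by case: h => // ->; rewrite mulr0.
    by move/eqP: xi; rewrite -(zero_t h).
have dM x : cone KI (powerset J) x -> pos_supp (d x) \in M.
  move=> xc; have [xK xL _] := xc.
  have [h|h] := lerP 0 (- threshold M I x).
    apply: cM.2 (thresholdP cM IM x).1 _; apply/fintype.subsetP => j.
    have jI : 0 < x j -> j \in I.
      move=> xj; move: xK; rewrite inE => /andP[_ /fintype.subsetP]; apply.
      by rewrite inE.
    rewrite !inE /d /c max_r // opprK; case: ifPn => jJ.
      by move=> ->; rewrite (fintype.subsetP JI).
    rewrite lt_max ltxx /= => hj; rewrite hj andbT; apply: jI; lra.
  apply: cM.2 (thresholdP cM IM x).1 _; apply/fintype.subsetP => j.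
  have jI : 0 < x j -> j \in I.
    move=> xj; move: xK; rewrite inE => /andP[_ /fintype.subsetP]; apply.
    by rewrite inE.
  rewrite !inE /d /c max_l ?ltW // subr0; case: ifPn => jJ.
    by move=> hj; rewrite jI //=; lra.
  by rewrite lt_max ltxx /= => hj; rewrite jI //=; lra.
have WU (x : vec) : cone M (powerset J) x -> cone KI (powerset J) x.
  by move=> [xM xJ xn]; split=> //; exact: closed_star_sub.
apply: (line_retract (f := d)) => [x|x xc|x xc i|x t|x t xc t01].
- exact: WU.
- have /= [|_ xJ xn] := line_cone x 0 xc; first by rewrite lexx ler01.
  have l0 : line (d x) x 0 = d x.
    by apply/funext => i; rewrite /line mul0r addr0.
  by rewrite l0 in xJ xn; split=> //; exact: dM.
- have dc : {for x, continuous (fun x : vec => x i - c x)}.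
    by apply: continuousB; [exact: continuous_coord|exact: cc].
  rewrite /d; case iJ: (i \in J) => //.
  by apply: continuous_maxr => //; exact: continuous_const.
- exact: line_cone.
- have xU := WU _ xc; suff -> : d x = x by rewrite line_id.
  have [xM _ _] := xc; apply/funext => i; rewrite /d cE // subr0.
  by case: ifPn => // iJ; rewrite max_r //; exact: outJ.
Qed.

End LinkCone.

(** * Realizations as cones *)

Section Realization.
Context (R : realType) (V T : finType).
Variables (G : {set {set V}}) (p : V -> T * bool) (A B : {set {set T}}).
Hypothesis p_inj : {in finset.cover G &, injective p}.
Hypothesis G_signs : forall s, s \in G ->
  [/\ [set i | (i, false) \in p @: s]%SET \in A,
      [set i | (i, true) \in p @: s]%SET \in B
    & forall i, ~~ (((i, false) \in p @: s) && ((i, true) \in p @: s))].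
Hypothesis signs_G : forall a b, a \in A -> b \in B ->
  (forall i, ~~ ((i \in a) && (i \in b))) ->
  exists2 s, s \in G &
    forall w, (w \in p @: s) = if w.2 then w.1 \in b else w.1 \in a.

Local Notation points := [set x : {ptws V -> R} |
    [/\ forall v, 0 <= x v, \sum_v x v = 1
      & [set v | x v != 0]%SET \in G]].
Local Notation C := (@cone R T A B).

Definition coeff (z : {ptws V -> R}) (w : T * bool) : R :=
  \sum_v (p v == w)%:R * z v.

Definition signed_coord (x : {ptws T -> R}) (w : T * bool) : R :=
  if w.2 then - x w.1 else x w.1.

Definition to_cone (z : {ptws V -> R}) : {ptws T -> R} :=
  fun i => coeff z (i, false) - coeff z (i, true).

Definition total (x : {ptws T -> R}) : R := \sum_i `|x i|.

Definition to_realization (x : {ptws T -> R}) : {ptws V -> R} :=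
  fun v => (total x)^-1 *
    ((v \in finset.cover G)%:R * Num.max 0 (signed_coord x (p v))).

Lemma mem_cover s v : s \in G -> v \in s -> v \in finset.cover G.
Proof. by move=> sG vs; apply/bigcupP; exists s. Qed.

Lemma coeff_vertex z v :
  points z -> v \in finset.cover G -> coeff z (p v) = z v.
Proof.
move=> [_ _ zG] vG;
  rewrite /coeff (bigD1 v) //= eqxx mul1r big1 ?addr0 // => v' vv'.
have [zv'|zv'] := eqVneq (z v') 0; first by rewrite zv' mulr0.
have v'G : v' \in finset.cover G by apply: mem_cover zG _; rewrite inE.
by case: eqP => [/p_inj e|]; rewrite ?mul0r //; rewrite e ?eqxx in vv'.
Qed.

Lemma coeff_ge0 z w : points z -> 0 <= coeff z w.
Proof. by move=> [z0 _ _]; apply: sumr_ge0 => v _; rewrite mulr_ge0. Qed.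

Lemma coeff_gt0 z w : points z ->
  (0 < coeff z w) = (w \in p @: [set v | z v != 0]%SET).
Proof.
move=> zR; have [z0 _ zG] := zR; apply/idP/imsetP => [wz|[v vs ->]].
  have [v v_z] : exists v, (p v == w)%:R * z v != 0.
    apply/existsP; apply: contraTT wz => /existsPn wz.
    by rewrite -leNgt /coeff big1 // => v _; apply/eqP; rewrite -[_ == _]negbK.
  exists v; first by rewrite inE; apply: contraNneq v_z => ->; rewrite mulr0.
  by apply/eqP; rewrite eq_sym; apply: contraNT v_z => /negbTE ->;
    rewrite mul0r.
rewrite coeff_vertex //; last by apply: mem_cover vs.
by rewrite lt_neqAle z0 andbT eq_sym; rewrite inE in vs.
Qed.

Lemma max_to_cone z w :
  points z -> Num.max 0 (signed_coord (to_cone z) w) = coeff z w.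
Proof.
move=> zR; have [z0 _ zG] := zR; have [_ _ /(_ w.1)] := G_signs zG.
rewrite -!coeff_gt0 // negb_and -!leNgt.
case: w => i b /=; have f0 := coeff_ge0 (i, false) zR;
  have t0 := coeff_ge0 (i, true) zR.
rewrite /signed_coord /to_cone /=; case: b => /orP[] h.
- have -> : coeff z (i, false) = 0 by apply: le_anti; rewrite h f0.
  by rewrite sub0r opprK max_r.
- have -> : coeff z (i, true) = 0 by apply: le_anti; rewrite h t0.
  by rewrite subr0 max_l // oppr_le0.
- have -> : coeff z (i, false) = 0 by apply: le_anti; rewrite h f0.
  by rewrite sub0r max_l // oppr_le0.
- have -> : coeff z (i, true) = 0 by apply: le_anti; rewrite h t0.
  by rewrite subr0 max_r.
Qed.

Lemma max_gt0 (x : R) : (0 < Num.max 0 x) = (0 < x).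
Proof. by rewrite lt_max ltxx. Qed.

Lemma to_cone_in z : points z -> C (to_cone z).
Proof.
move=> zR; have [z0 z1 zG] := zR; have [zA zB _] := G_signs zG.
have signE w :
    (0 < signed_coord (to_cone z) w) = (w \in p @: [set v | z v != 0]%SET).
  by rewrite -coeff_gt0 // -max_to_cone // max_gt0.
split.
- by rewrite (_ : pos_supp _ =
    [set i | (i, false) \in p @: [set v | z v != 0]]%SET) //;
    apply/setP => i; rewrite !inE -signE.
- by rewrite (_ : neg_supp _ =
    [set i | (i, true) \in p @: [set v | z v != 0]]%SET) //;
    apply/setP => i; rewrite !inE -signE /signed_coord oppr_gt0.
- have [v vz] : exists v, z v != 0.
    apply: contrapT => z_0; have /eqP := z1;
      rewrite big1 ?(eq_sym 0) ?oner_eq0 //.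
    by move=> v _; apply: contrapT => /eqP zv; apply: z_0; exists v.
  have v_pos : 0 < signed_coord (to_cone z) (p v).
    by rewrite signE imset_f // inE.
  exists (p v).1; apply: contraTneq v_pos => e.
  by rewrite /signed_coord e oppr0 if_same ltxx.
Qed.

Lemma total_gt0 x : C x -> 0 < total x.
Proof.
by move=> [_ _ [i xi]]; apply: (@sum_gt0 _ _ _ i) => [j|];
  rewrite ?normr_ge0 ?normr_eq0.
Qed.

Lemma sum_max_signed x : \sum_w Num.max 0 (signed_coord x w) = total x.
Proof.
rewrite -(pair_big xpredT xpredT (fun i b =>
  Num.max 0 (signed_coord x (i, b)))) /=.
apply: eq_bigr => i _; rewrite big_bool /signed_coord /=.
case: (lerP 0 (x i)) => xi;
  last by rewrite ltr0_norm // max_r ?addr0 // oppr_ge0 ltW.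
by rewrite max_l ?add0r ?ger0_norm // oppr_le0.
Qed.

Lemma signed_support x : C x -> exists2 s, s \in G &
  forall w, (w \in p @: s) = (0 < signed_coord x w).
Proof.
move=> [xA xB _]; have [|s sG sE] := signs_G xA xB.
  by move=> i; rewrite !inE; apply/negP => /andP[/lt_trans h /h]; rewrite ltxx.
by exists s => // w; rewrite sE /signed_coord; case: w.2; rewrite inE ?oppr_gt0.
Qed.

Lemma to_realization_gt0 x s v : C x -> s \in G ->
  (forall w, (w \in p @: s) = (0 < signed_coord x w)) ->
  (0 < to_realization x v) = (v \in s).
Proof.
move=> xC sG sE; rewrite /to_realization pmulr_rgt0 ?invr_gt0 ?total_gt0 //.
case: (boolP (v \in finset.cover G)) => vG; last first.
  rewrite mul0r ltxx; apply/esym/negbTE; apply: contra vG; exact: mem_cover.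
rewrite mul1r max_gt0 -sE; apply/imsetP/idP => [[v' vs' /p_inj e]|vs].
  by rewrite e //; exact: mem_cover vs'.
by exists v.
Qed.

Lemma to_realization_ge0 x v : C x -> 0 <= to_realization x v.
Proof.
move=> xC; apply: mulr_ge0; first by rewrite invr_ge0 ltW // total_gt0.
by apply: mulr_ge0; rewrite ?ler0n // le_max lexx.
Qed.

Lemma to_realization_in x : C x -> points (to_realization x).
Proof.
move=> xC; have [s sG sE] := signed_support xC.
have sE' v := to_realization_gt0 v xC sG sE.
have x0 v := to_realization_ge0 v xC.
split=> //; last first.
  rewrite (_ : [set v | _]%SET = s) //; apply/setP => v.
  by rewrite inE -sE' lt_neqAle x0 andbT eq_sym.
rewrite -mulr_sumr -[RHS](@mulVf _ (total x)) ?gt_eqF ?total_gt0 //.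
congr (_ * _); rewrite -sum_max_signed.
rewrite [RHS](bigID (mem (p @: s))) /= [X in _ = _ + X]big1 ?addr0; last first.
  by move=> w; rewrite sE -leNgt => ?; rewrite max_l.
have sinj : {in s &, injective p}.
  by move=> u v us vs; apply: p_inj; apply: mem_cover sG _.
rewrite big_imset //= (bigID (mem s)) /= [X in _ + X]big1 ?addr0.
  by apply: eq_bigr => v vs; rewrite (mem_cover sG vs) mul1r.
move=> v vs; have [vG|] := boolP (v \in finset.cover G); last by rewrite mul0r.
rewrite mul1r max_l // leNgt -sE; apply: contra vs => /imsetP[u us /p_inj e].
by rewrite e // (mem_cover sG us).
Qed.

Lemma to_realizationK x : C x ->
  to_cone (to_realization x) = (fun i => (total x)^-1 * x i).
Proof.
move=> xC; have [s sG sE] := signed_support xC.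
have xR := to_realization_in xC.
have sE' v := to_realization_gt0 v xC sG sE.
have x0 v := to_realization_ge0 v xC.
have cE w : coeff (to_realization x) w =
    (total x)^-1 * Num.max 0 (signed_coord x w).
  have [/imsetP[v vs ->]|ws] := boolP (w \in p @: s).
    rewrite coeff_vertex // ?(mem_cover sG vs) //.
    by rewrite /to_realization (mem_cover sG vs) mul1r.
  move: (ws); rewrite sE -leNgt => ?; rewrite max_l // mulr0.
  apply: le_anti; rewrite coeff_ge0 // andbT leNgt coeff_gt0 //.
  rewrite (_ : [set v | _]%SET = s) //; apply/setP => v.
  by rewrite inE -sE' lt_neqAle x0 andbT eq_sym.
apply/funext => i; rewrite /to_cone !cE -mulrBr; congr (_ * _).
rewrite /signed_coord /=; case: (lerP 0 (x i)) => xi.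
  by rewrite max_l ?oppr_le0 // subr0.
by rewrite max_r ?sub0r ?opprK // oppr_ge0 ltW.
Qed.

Lemma to_coneK z : points z -> to_realization (to_cone z) = z.
Proof.
move=> zR; have zC := to_cone_in zR; have [_ s1 _] := to_realization_in zC.
have [z0 z1 zG] := zR.
have E v : to_realization (to_cone z) v = (total (to_cone z))^-1 * z v.
  rewrite /to_realization max_to_cone //; congr (_ * _).
  have [vG|vG] := boolP (v \in finset.cover G);
    first by rewrite mul1r coeff_vertex.
  rewrite mul0r; apply/esym/eqP; apply: contraNT vG => zv.
  by apply: mem_cover zG _; rewrite inE.
(* Both z and its image have coordinates of sum 1. *)
have N1 : (total (to_cone z))^-1 = 1.
  by move: s1; under eq_bigr do rewrite E; rewrite -mulr_sumr z1 mulr1.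
by apply/funext => v; rewrite E N1 mul1r.
Qed.

(** A vertex v is placed on the half axis p v, where (i, true) is the
negative half of the i-th axis. The absolute values of the coordinates of a
vector, divided by their sum, are then the barycentric coordinates. Injectivity
of p is asked on vertices of faces only, because ghost vertices of a link may
share a half axis with vertices of its suspension. *)
Lemma realization_cone : homotopy_equivalent R (realization R G) (set_type C).
Proof.
apply: (@line_equivalence _ _ _ _ _ to_cone to_realization).
- exact: to_cone_in.
- exact: to_realization_in.
- move=> z _ i; apply: continuousB; apply: continuous_sum => v.
    by apply: continuousM; [exact: continuous_const|exact: continuous_coord].
  by apply: continuousM; [exact: continuous_const|exact: continuous_coord].
- move=> x xC v; apply: continuousM.
    apply: continuousV; first by rewrite gt_eqF // total_gt0.
    apply: continuous_sum => i.
    apply: (@continuous_comp _ _ _ (fun x : {ptws T -> R} => x i) Num.norm).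
      exact: continuous_coord.
    exact: norm_continuous.
  apply: continuousM; first exact: continuous_const.
  apply: continuous_maxr; first exact: continuous_const.
  rewrite /signed_coord; case: (p v) => i [] /=; last exact: continuous_coord.
  by apply: continuousN; exact: continuous_coord.
- by move=> z t zR _; rewrite to_coneK // line_id.
- move=> x t xC t01; rewrite to_realizationK //; apply: cone_line_scale => //.
  by rewrite invr_gt0 total_gt0.
Qed.

End Realization.

(** * Bier spheres and iterated suspensions *)

Lemma inl_disj_union (S T : finType) (s : {set S}) (t : {set T}) i :
  (inl i \in disj_union s t) = (i \in s).
Proof.
rewrite inE mem_imset; last by move=> ? ? [].
by rewrite [X in _ || X](_ : _ = false) ?orbF //; apply/negbTE/imsetP => -[].
Qed.

Lemma inr_disj_union (S T : finType) (s : {set S}) (t : {set T}) i :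
  (inr i \in disj_union s t) = (i \in t).
Proof.
rewrite inE [X in X || _](_ : _ = false); last by apply/negbTE/imsetP => -[].
by rewrite mem_imset // => ? ? [].
Qed.

Lemma disj_union_sub (S T : finType) (s I : {set S}) (t J : {set T}) :
  (disj_union s t \subset disj_union I J) = (s \subset I) && (t \subset J).
Proof.
apply/fintype.subsetP/andP =>
  [st|[/fintype.subsetP sI /fintype.subsetP tJ] [i|i]].
- by split; apply/fintype.subsetP => i;
    [have := st (inl i); rewrite !inl_disj_union
    |have := st (inr i); rewrite !inr_disj_union].
- by rewrite !inl_disj_union; exact: sI.
- by rewrite !inr_disj_union; exact: tJ.
Qed.

Lemma disj_union_parts (S T : finType) (u : {set S + T}) :
  u = disj_union [set i | inl i \in u]%SET [set i | inr i \in u]%SET.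
Proof.
by apply/setP => -[i|i]; rewrite ?inl_disj_union ?inr_disj_union inE.
Qed.

Lemma imset_bar m (s : {set 'I_m}) : @bar m @: s = s.
Proof. by apply/setP => i; apply/imsetP/idP => [[j js ->]|is_]//; exists i. Qed.

Lemma in_alexander_dual m (K : {set {set 'I_m}}) (s : {set 'I_m}) :
  (s \in alexander_dual K) = (~: s \notin K).
Proof.
apply/imsetP/idP => [[t tK ->]|sK]; first by rewrite imset_bar; move: tK;
  rewrite inE.
by exists s; rewrite ?imset_bar // inE.
Qed.

Lemma in_bier m (K : {set {set 'I_m}}) (s t : {set 'I_m}) :
  (disj_union s t \in bier K) =
  [&& s \in K, t \in alexander_dual K & s :&: t == finset.set0].
Proof.
apply/imset2P/and3P => [[s' t' s'K]|[sK tK st]].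
  rewrite inE imset_bar -setI_eq0 => /andP[t'L st'] e.
  have -> : s = s' by apply/setP => i;
    rewrite -(inl_disj_union s t) e inl_disj_union.
  by have -> : t = t' by apply/setP => i;
    rewrite -(inr_disj_union s t) e inr_disj_union.
by exists s t; rewrite ?inE ?imset_bar -?setI_eq0 ?tK.
Qed.

Lemma complex_alexander_dual m (K : {set {set 'I_m}}) :
  simplicial_complex K -> K <> powerset [set: 'I_m]%SET ->
  simplicial_complex (alexander_dual K).
Proof.
move=> [K0 Kd] Kn; split; last first.
  move=> s t; rewrite !in_alexander_dual => tK st; apply: contra tK => sK.
  by apply: Kd sK _; rewrite finset.setCS.
rewrite in_alexander_dual finset.setC0; apply/negP => KT; apply: Kn.
apply/setP => s; rewrite powersetE finset.subsetT.
by apply: Kd KT _; exact: finset.subsetT.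
Qed.

Lemma realization_bier (R : realType) m (K : {set {set 'I_m}})
    (I J : {set 'I_m}) :
  homotopy_equivalent R
    (realization R (full_subcomplex (bier K) (disj_union I (@bar m @: J))))
    (set_type (@cone R _ (full_subcomplex K I)
      (full_subcomplex (alexander_dual K : {set {set 'I_m}}) J))).
Proof.
pose p (v : 'I_m + 'I_m) : 'I_m * bool :=
  match v with inl i => (i, false) | inr i => (i, true) end.
have pl s t (i : 'I_m) : ((i, false) \in p @: disj_union s t) = (i \in s).
  by rewrite -(inl_disj_union s t) -[(i, false)]/(p (inl i)) mem_imset // =>
    -[?|?] [?|?] //= [->].
have pr s t (i : 'I_m) : ((i, true) \in p @: disj_union s t) = (i \in t).
  by rewrite -(inr_disj_union s t) -[(i, true)]/(p (inr i)) mem_imset // =>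
    -[?|?] [?|?] //= [->].
apply: (@realization_cone R _ _ _ p).
- by move=> [?|?] [?|?] _ _ //= [->].
- move=> u; rewrite imset_bar (disj_union_parts u); set s := [set i | _]%SET.
  set t := [set i | inr i \in u]%SET.
  rewrite inE in_bier disj_union_sub =>
    /andP[/and3P[sK tK /eqP st] /andP[sI tJ]].
  split=> [||i]; last by rewrite pl pr -finset.in_setI st inE.
    by rewrite (_ : [set i | _]%SET = s) ?inE ?sK //; apply/setP => i;
      rewrite inE pl.
  by rewrite (_ : [set i | _]%SET = t) ?inE ?tK //; apply/setP => i;
    rewrite inE pr.
- move=> a b; rewrite !inE => /andP[aK aI] /andP[bL bJ] ab;
    exists (disj_union a b).
    rewrite inE imset_bar in_bier aK bL disj_union_sub aI bJ !andbT /=.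
    by apply/eqP/setP => i; rewrite !inE; exact/negbTE.
  by move=> [i []] /=; rewrite ?pl ?pr.
Qed.

Lemma in_two_points (t : {set bool}) :
  (t \in two_points) = ~~ ((true \in t) && (false \in t)).
Proof.
rewrite !inE; apply/idP/idP.
  by move=> /orP[/orP[]|] /eqP ->; rewrite !inE.
case tt : (true \in t); case ft : (false \in t) => // _.
- by rewrite [t == [set true]%SET](_ : _ = true) ?orbT //;
    apply/eqP/setP => -[];
    rewrite !inE ?tt ?ft.
- by rewrite [t == [set false]%SET](_ : _ = true) ?orbT //;
    apply/eqP/setP => -[];
    rewrite !inE ?tt ?ft.
- by rewrite [t == finset.set0](_ : _ = true) //; apply/eqP/setP => -[];
    rewrite !inE ?tt ?ft.
Qed.

(** The nested sum types of an iterated suspension are unwound into S and k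
pairs of antipodal points: the complex is the join of G with the boundary of a
cross-polytope. *)
Lemma suspension_vertices (S : finType) (k : nat) (G : {set {set S}}) :
  exists psi : S + 'I_k * bool -> susp_vertices S k, bijective psi /\
  forall s, (s \in suspension k G) = ([set v | psi (inl v) \in s]%SET \in G) &&
    [forall j,
      ~~ ((psi (inr (j, true)) \in s) && (psi (inr (j, false)) \in s))].
Proof.
elim: k => [|k [psi [[phi psiK phiK] psiE]]].
  exists (fun v : S + 'I_0 * bool => match v with
    | inl v => v | inr w => False_rect S (notF (ltn_ord w.1)) end).
  split.
    exists inl => [[v|[[]]]|] //.
  move=> s /=; rewrite [X in _ && X](_ : _ = true) ?andbT;
    last by apply/forallP => -[].
  by rewrite [X in _ = (X \in G)](_ : _ = s) //; apply/setP => v; rewrite inE.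
pose psi' (v : S + 'I_k.+1 * bool) : susp_vertices S k.+1 :=
  match v with
  | inl v => inl (psi (inl v))
  | inr (j, b) =>
      if unlift ord0 j is Some j' then inl (psi (inr (j', b))) else inr b
  end.
pose phi' (v : susp_vertices S k.+1) : S + 'I_k.+1 * bool :=
  match v with
  | inl v => match phi v with
             | inl v => inl v
             | inr (j, b) => inr (lift ord0 j, b)
             end
  | inr b => inr (ord0, b)
  end.
exists psi'; split.
  exists phi'.
    move=> [v|[j b]] /=; first by rewrite psiK.
    by case: unliftP => [j' ->|->] /=; rewrite ?psiK.
  move=> [v|b] /=; last by rewrite unlift_none.
  case e: (phi v) => [w|[j b]] /=; first by rewrite -e phiK.
  by rewrite liftK -e phiK.
move=> u; rewrite (disj_union_parts u); set s := [set i | _]%SET.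
set t := [set i | inr i \in u]%SET.
have -> : (disj_union s t \in suspension k.+1 G) =
    (s \in suspension k G) && (t \in two_points).
  apply/imset2P/andP => [[s' t' s'G t'P] e|[sG tP]]; last by exists s t.
  have -> : s = s' by apply/setP => i;
    rewrite -(inl_disj_union s t) e inl_disj_union.
  by have -> : t = t' by apply/setP => i;
    rewrite -(inr_disj_union s t) e inr_disj_union.
rewrite in_two_points psiE -andbA; congr (_ && _).
  rewrite [X in (X \in G) = _](_ : _ =
    [set v | psi' (inl v) \in disj_union s t]%SET) //.
  by apply/setP => v; rewrite [LHS]inE [RHS]inE inl_disj_union.
apply/andP/forallP => [[/forallP h0 h1] j|h].
  rewrite /psi'; case: unliftP => [j' _|_];
    rewrite ?inl_disj_union ?inr_disj_union //.
split; last by have := h ord0; rewrite /psi' unlift_none !inr_disj_union.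
by apply/forallP => j; have := h (lift ord0 j);
  rewrite /psi' liftK !inl_disj_union.
Qed.

(** * Suspensions as cones, and faces of the cross-polytope *)

(** The j-th pair of suspension points becomes the two halves of the j-th
axis of J, and a vertex of the link the positive half of its axis. A vertex in J
is a ghost of the link, which makes room for the suspension points. *)
Lemma realization_suspension (R : realType) (T : finType) (K : {set {set T}})
    (J : {set T}) : simplicial_complex K ->
  homotopy_equivalent R (realization R (suspension #|J| (link J K)))
    (set_type (@cone R T (closed_star J K) (powerset J))).
Proof.
move=> cK; have [psi [[phi psiK phiK] psiE]] :=
  suspension_vertices #|J| (link J K).
pose p' (w : T + 'I_#|J| * bool) : T * bool :=
  match w with inl i => (i, false) | inr (j, b) => (enum_val j, b) end.
pose p v := p' (phi v).
have linkP s i : s \in suspension #|J| (link J K) -> psi (inl i) \in s ->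
    i \notin J.
  rewrite psiE => /andP[+ _] i_s;
    rewrite inE => /and3P[_ + _] => /pred0P/(_ i) /=.
  by rewrite inE i_s andbT => ->.
have in_p (s : {set susp_vertices T #|J|}) w :
    w \in p @: s -> exists2 u, psi u \in s & w = p' u.
  by move=> /imsetP[v vs ->]; exists (phi v); rewrite ?phiK.
have p_in (s : {set susp_vertices T #|J|}) u : psi u \in s -> p' u \in p @: s.
  by move=> us; apply/imsetP; exists (psi u) => //; rewrite /p psiK.
apply: (@realization_cone R _ _ _ p).
- move=> v w /bigcupP[s sG vs] /bigcupP[t tG wt].
  rewrite -(phiK v) in vs *; rewrite -(phiK w) in wt *; rewrite /p !psiK.
  move: (phi v) (phi w) vs wt => [i|[j b]] [i'|[j' b']] vs wt /=.
  + by case=> ->.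
  + by case=> e _; have := linkP _ _ sG vs; rewrite e enum_valP.
  + by case=> e _; have := linkP _ _ tG wt; rewrite -e enum_valP.
  + by case=> /enum_val_inj -> ->.
- move=> s sG; have := sG; rewrite psiE => /andP[+ /forallP sign].
  rewrite inE => /and3P[_ _ JsK]; split.
  + rewrite inE; apply: cK.2 JsK _; apply/fintype.subsetP => i.
    rewrite !inE => /orP[/in_p[[i'|[j b]] us]|->] //= [->].
      by rewrite us orbT.
    by rewrite enum_valP.
  + rewrite powersetE; apply/fintype.subsetP => i; rewrite inE.
    by move=> /in_p[[i'|[j b]] us] // [-> _]; exact: enum_valP.
  + move=> i; apply/negP => /andP[/in_p[u us ue] /in_p[u' us' ue']].
    case: u' us' ue' => [//|[j' b']] us' [ie be]; subst b'.
    case: u us ue => [i'|[j b]] us; first case=> ie'.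
      by have := linkP _ _ sG us; rewrite -ie' ie enum_valP.
    move=> [ie' be']; have jj : j = j' by apply: enum_val_inj; rewrite -ie' ie.
    by subst j b; have := sign j'; rewrite us us'.
- move=> a b; rewrite inE powersetE => aK /fintype.subsetP bJ ab.
  pose mem_u (u : T + 'I_#|J| * bool) := match u with
    | inl i => (i \in a) && (i \notin J)
    | inr (j, c) => enum_val j \in (if c then b else a) end.
  pose S := [set v | mem_u (phi v)]%SET; exists S.
    rewrite psiE; apply/andP; split; last first.
      apply/forallP => j; rewrite !inE !psiK /=; rewrite andbC; exact: ab.
    have aE : [set v | psi (inl v) \in S]%SET = (a :\: J)%SET.
      by apply/setP => i; rewrite !inE psiK /= andbC.
    rewrite aE inE; apply/and3P; split.
    + apply: cK.2 aK _; apply: finset.subsetU; apply/orP; left;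
        exact: finset.subsetDl.
    + by apply/pred0P => i /=; rewrite !inE; case: (i \in J).
    + by apply: cK.2 aK _; apply/fintype.subsetP => i; rewrite !inE;
        case: (i \in J); rewrite ?orbT // orbF.
  move=> [i c]; apply/idP/idP => /=.
    move=> /in_p[[i'|[j c']]]; rewrite inE psiK /=;
      first by move=> /andP[ia _] [-> ->].
    by move=> h [-> ->]; case: c' h.
  case: c => [ib|ia].
    have iJ := bJ _ ib.
    have := p_in S (inr (enum_rank_in iJ i, true)).
    by rewrite /= enum_rankK_in //; apply; rewrite inE psiK /= enum_rankK_in.
  have [iJ|iJ] := boolP (i \in J); last first.
    by apply: (p_in S (inl i)); rewrite inE psiK /= ia.
  have := p_in S (inr (enum_rank_in iJ i, false)).
  by rewrite /= enum_rankK_in //; apply; rewrite inE psiK /= enum_rankK_in.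
Qed.

(** A functional that is maximal at two opposite vertices has maximum 0, so it
vanishes and its face is not proper. Conversely, the sum of the vertices in s, as
a functional, is at most 1 on the polytope if no two of them are opposite, and
takes the value 1 at the vertices in s only. *)
Lemma in_cross_polytope_boundary (R : realType) n (s : {set 'I_n * bool}) :
  (s \in cross_polytope_boundary R n) =
  [forall j, ~~ (((j, true) \in s) && ((j, false) \in s))].
Proof.
have vertexE (a : 'rV[R]_n) p :
    \sum_j a ord0 j * cross_vertex R p ord0 j = (-1) ^+ p.2 * a ord0 p.1.
  rewrite (bigD1 p.1) //= big1 ?addr0 => [|j jp];
    rewrite /cross_vertex !mxE eqxx /=.
    by rewrite eqxx mulr1 mulrC.
  by rewrite (negbTE jp) mulr0 mulr0.
have vertexP (p : 'I_n * bool) : cross_polytope (cross_vertex R p).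
  rewrite /cross_polytope /= (bigD1 p.1) //= big1 ?addr0 => [|j jp];
    rewrite /cross_vertex !mxE eqxx /=.
    by rewrite eqxx mulr1 normrX normrN1 expr1n.
  by rewrite (negbTE jp) mulr0 normr0.
rewrite inE; apply/asboolP/forallP => [[F [a [c [ac -> FP]]] sF] j|s_signs].
  apply/negP => /andP[/sF [_ /= h1] /sF [_ /= h0]].
  have {}h0 : a ord0 j = c by rewrite vertexE /= expr0 mul1r in h0.
  have {}h1 : - a ord0 j = c by rewrite vertexE /= expr1 mulN1r in h1.
  have c0 : c = 0 by lra.
  have a0 i : a ord0 i = 0.
    have := ac _ (vertexP (i, false)); have := ac _ (vertexP (i, true)).
    by rewrite !vertexE /= expr0 expr1 mul1r mulN1r; lra.
  apply: FP; apply/seteqP; split=> [x []//|x Px]; split=> //=.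
  by rewrite big1 ?c0 // => i _; rewrite a0 mul0r.
(* The sum of the vertices in s; (j, true) is the vertex - e_j. *)
pose a : 'rV[R]_n := \row_j (((j, false) \in s)%:R - ((j, true) \in s)%:R).
have a1 j : `|a ord0 j| <= 1.
  rewrite mxE; case: (_ \in s); case: (_ \in s);
    by rewrite ?subrr ?subr0 ?sub0r ?normrN ?normr0 ?normr1.
exists (@cross_polytope R n `&` [set x | \sum_j a ord0 j * x ord0 j = 1]).
  exists a, 1; split=> // [x xP|e].
    apply: le_trans xP; apply: ler_sum => j _; apply: le_trans (ler_norm _) _.
    by rewrite normrM ler_piMl.
  have /= := esym e; move/(congr1 (fun P => P (0 : 'rV[R]_n))) => /= h.
  have : cross_polytope (0 : 'rV[R]_n).
    by rewrite /cross_polytope /= big1 ?ler01 // => j _; rewrite mxE normr0.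
  rewrite h => -[_ /=]; rewrite big1 => [/esym/eqP|j _];
    first by rewrite oner_eq0.
  by rewrite !mxE mulr0.
move=> [j b]; have := s_signs j => sj; split=> [js|[_ /=]].
  split=> //=; rewrite vertexE /= mxE.
  case: b js => js; move: sj; rewrite js ?andbT /= => /negbTE ->.
    by rewrite expr1 mulN1r sub0r opprK.
  by rewrite expr0 mul1r subr0.
rewrite vertexE /= mxE; case: b.
  by case: ((j, true) \in s) => //; case: ((j, false) \in s) => //= h;
    exfalso; move: h; rewrite expr1; lra.
by case: ((j, false) \in s) => //; case: ((j, true) \in s) => //= h; exfalso;
  move: h; rewrite expr0; lra.
Qed.

(** * Dual pairs of complexes *)

Section DualPair.
Context (R : realType) (T : finType).
Variables (K L : {set {set T}}) (I J : {set T}).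
Hypotheses (cK : simplicial_complex K) (cL : simplicial_complex L).
Hypothesis dualKL : forall s, (s \in L) = (~: s \notin K).
Hypothesis IJ : ~~ (I \subset J).

Local Notation KI := (full_subcomplex K I).
Local Notation LJ := (full_subcomplex L J).

(** When I is a face of K both sides are contractible, as the link of J is
then a full simplex. Otherwise the two retractions are composed. *)
Lemma dual_cone_link : J \subset I -> J \in K ->
  homotopy_equivalent R (set_type (@cone R T KI LJ))
    (set_type (@cone R T (closed_star J KI) (powerset J))).
Proof.
move=> JI JK; have [IK|IK] := boolP (I \in K); last first.
  apply: homotopy_equivalent_trans (cone_retract_star R cK IK JK JI).
  by apply: homotopy_equivalent_sym; exact: cone_retract_up.
have starI : closed_star J (powerset I) = powerset I.
  by apply/setP => s; rewrite inE !powersetE finset.subUset JI andbT.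
rewrite full_powerset // starI.
apply: (@homotopy_equivalent_trans _ _ (one_point R)).
  by apply: cone_powerset_contractible;
    [exact: complex_full|rewrite inE negb_and IJ orbT].
apply: homotopy_equivalent_sym.
by apply: cone_powerset_contractible;
  [exact: complex_powerset|rewrite powersetE].
Qed.

(** If I is a face of K, move towards the indicator of I. If not, raise to
the cone where L is forgotten, and there move towards the opposite of the
indicator of J. *)
Lemma dual_cone_contractible : ~~ ((J \subset I) && (J \in K)) ->
  homotopy_equivalent R (set_type (@cone R T KI LJ)) (one_point R).
Proof.
move=> JIK; have [IK|IK] := boolP (I \in K).
  rewrite full_powerset //.
  by apply: cone_powerset_contractible;
    [exact: complex_full|rewrite inE negb_and IJ orbT].
apply: (@homotopy_equivalent_trans _ _ (set_type (@cone R T KI (powerset J)))).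
  by apply: homotopy_equivalent_sym; exact: cone_retract_up.
apply: powerset_cone_contractible; first exact: complex_full.
by rewrite inE andbC.
Qed.

End DualPair.

(** Both conditions on faces hold for every pair of disjoint subsets of I,
and these pairs are the sets of vertices without two opposite ones. *)
Lemma bier_cross_polytope (R : realType) m (K : {set {set 'I_m}})
    (I : {set 'I_m}) :
  simplicial_complex K -> simplicial_complex (alexander_dual K) ->
  I \in K -> I \in alexander_dual K ->
  simplicial_iso (full_subcomplex (bier K) (disj_union I (@bar m @: I)))
    (cross_polytope_boundary R #|I|).
Proof.
move=> cK cL IK IL.
pose f (w : 'I_#|I| * bool) : 'I_m + 'I_m :=
  if w.2 then inr (enum_val w.1) else inl (enum_val w.1).
have f_inj : injective f.
  by move=> [i b] [j c]; rewrite /f /=; case: b;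
    case: c => //= -[] /enum_val_inj ->.
exists f; split; first by move=> x y _ _; exact: f_inj.
apply/setP => u; rewrite imset_bar (disj_union_parts u).
set s := [set i | inl i \in u]%SET; set t := [set i | inr i \in u]%SET.
rewrite inE in_bier disj_union_sub.
apply/idP/imsetP => [/andP[/and3P[sK tL /eqP st] /andP[sI tI]]|[v]].
  pose v := [set w | f w \in disj_union s t]%SET.
  have vE w : (w \in v) = (f w \in disj_union s t) by rewrite inE.
  exists v.
    rewrite in_cross_polytope_boundary; apply/forallP => j; rewrite !vE /f /=.
    rewrite inl_disj_union inr_disj_union andbC; apply/negP => h.
    by have := finset.in_set0 (enum_val j); rewrite -st finset.in_setI h.
  apply/setP => w; apply/idP/imsetP => [wst|[w']]; last by rewrite vE => ? ->.
  case: w wst => i; rewrite ?inl_disj_union ?inr_disj_union => i_.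
    have iI := fintype.subsetP sI _ i_.
    exists (enum_rank_in iI i, false); last by rewrite /f /= enum_rankK_in.
    by rewrite vE /f /= enum_rankK_in // inl_disj_union.
  have iI := fintype.subsetP tI _ i_.
  exists (enum_rank_in iI i, true); last by rewrite /f /= enum_rankK_in.
  by rewrite vE /f /= enum_rankK_in // inr_disj_union.
rewrite in_cross_polytope_boundary => /forallP v_signs uv.
have sE i : i \in s -> exists2 j, i = enum_val j & (j, false) \in v.
  rewrite -(inl_disj_union s t) uv => /imsetP[[j []] jv] //.
  by case=> ->; exists j.
have tE i : i \in t -> exists2 j, i = enum_val j & (j, true) \in v.
  rewrite -(inr_disj_union s t) uv => /imsetP[[j []] jv] //.
  by case=> ->; exists j.
have sI : s \subset I.
  by apply/fintype.subsetP => i /sE[j -> _]; exact: enum_valP.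
have tI : t \subset I.
  by apply/fintype.subsetP => i /tE[j -> _]; exact: enum_valP.
rewrite sI tI (cK.2 _ _ IK sI) (cL.2 _ _ IL tI) /= andbT.
apply/eqP/setP => i; rewrite finset.in_setI finset.in_set0; apply/negbTE/negP.
move=> /andP[/sE[j -> jv] /tE[j' /enum_val_inj e j'v]]; subst j'.
by have := v_signs j; rewrite jv j'v.
Qed.

Theorem theorem1p1 (R : realType) (m : nat) (K : {set {set 'I_m}})
    (I J : {set 'I_m}) :
  (0 < m)%N -> simplicial_complex K -> K <> powerset [set: 'I_m] ->
  let barI := (@bar m) @: I in
  let barJ := (@bar m) @: J in
  let K_dual := alexander_dual K in
  let B := full_subcomplex (bier K) (disj_union I barJ) in
  let equivalent_to := homotopy_equivalent R (realization R B) in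
  let case1 := [/\ I = J, I \in K & barI \in K_dual] in
  let case2 := [/\ I = J, I \notin K & barI \notin K_dual] in
  let case3 := J \proper I /\ J \in K in
  let case4 := I \proper J /\ barI \in K_dual in
  [/\ case1 -> equivalent_to (sphere R (#|I|%:Z - 1)),
      case2 -> equivalent_to (sphere R (#|I|%:Z - 2)),
      case3 -> equivalent_to (realization R
        (suspension #|J| (link J (full_subcomplex K I)))),
      case4 -> equivalent_to (realization R
        (suspension #|I| (link barI (full_subcomplex K_dual barJ))))
    & ~ case1 -> ~ case2 -> ~ case3 -> ~ case4 ->
        equivalent_to (one_point R)] /\
  (case1 -> simplicial_iso B (cross_polytope_boundary R #|I|)).
Proof.
move=> _ cK Kn barI barJ K_dual B equivalent_to case1 case2 case3 case4.
have cL := complex_alexander_dual cK Kn.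
pose L : {set {set 'I_m}} := alexander_dual K.
have dualKL s : (s \in L) = (~: s \notin K) := in_alexander_dual K s.
(* K is the dual of L, so what holds of dual pairs applies to (L, K) too. *)
have dualLK s : (s \in K) = (~: s \notin L).
  by rewrite dualKL finset.setCK negbK.
have barIE : barI = I by exact: imset_bar.
have barJE : barJ = J by exact: imset_bar.
have BE := realization_bier R K I J.
have equivalentP Y : homotopy_equivalent R
    (set_type (@cone R _ (full_subcomplex K I) (full_subcomplex L J))) Y ->
  equivalent_to Y by exact: homotopy_equivalent_trans BE.
have oppositeP Y : homotopy_equivalent R
    (set_type (@cone R _ (full_subcomplex L J) (full_subcomplex K I))) Y ->
  equivalent_to Y.
  by move=> h; apply: equivalentP;
    exact: homotopy_equivalent_trans (cone_opp _ _ _) h.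
split; last first.
  rewrite /case1 barIE /B /barJ => -[<- IK IL].
  exact: bier_cross_polytope.
split.
- rewrite /case1 barIE => -[IJ IK IL]; apply: equivalentP; rewrite -IJ.
  rewrite !full_powerset //; apply: cone_sphere.
  by rewrite subrK.
- rewrite /case2 barIE => -[IJ IK IL]; apply: equivalentP; rewrite -IJ.
  have [i0 i0I] : exists i, i \in I.
    by apply/set0Pn; apply: contraNneq IK => ->; exact: cK.1.
  apply: homotopy_equivalent_trans (cone_diagonal R cK cL dualKL IK i0I IL) _.
  apply: cone_sphere; rewrite (cardsD1 i0 I) i0I.
  by rewrite PoszD -[2]/(1 + 1) opprD addrA addrAC addrK addrAC subrr add0r.
- rewrite /case3 properE => -[/andP[JI IJ] JK]; apply: equivalentP.
  apply: homotopy_equivalent_trans (dual_cone_link R cK cL dualKL IJ JI JK) _.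
  apply: homotopy_equivalent_sym; apply: realization_suspension.
  exact: complex_full.
- rewrite /case4 properE barIE barJE => -[/andP[IJ JI] IL]; apply: oppositeP.
  apply: homotopy_equivalent_trans (dual_cone_link R cL cK dualLK JI IJ IL) _.
  apply: homotopy_equivalent_sym; apply: realization_suspension.
  exact: complex_full.
- rewrite /case1 /case2 /case3 /case4 barIE !properE => h1 h2 h3 h4.
  have [IJ|IJ] := boolP (I \subset J); last first.
    apply: equivalentP; apply: dual_cone_contractible => //.
    by apply/negP => /andP[JI JK]; apply: h3; rewrite JI.
  have [JI|JI] := boolP (J \subset I); last first.
    apply: oppositeP; apply: dual_cone_contractible => //.
    by apply/negP => /andP[_ IL]; apply: h4; rewrite IJ.
  have e : I = J by apply/eqP; rewrite finset.eqEsubset IJ.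
  apply: equivalentP; rewrite -e; have [IK|IK] := boolP (I \in K).
    rewrite full_powerset //; apply: cone_powerset_contractible;
      first exact: complex_full.
    by rewrite inE negb_and; apply/orP; left; apply/negP => IL; apply: h1;
      rewrite -e.
  have IL : I \in L by apply: contrapT => /negP IL; apply: h2.
  rewrite [full_subcomplex L I]full_powerset //.
  apply: powerset_cone_contractible; first exact: complex_full.
  by rewrite inE negb_and IK.
Qed.
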